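(* Let $J_j(x)=\tfrac{c_j}{2}x^2+\bar c_jx$ with $c_j>0$, and let $\rho\in(0,\,4\min_jc_j)$. Consider the system in the variables $z=(\hat q,\tilde\theta)\in\mathbb{R}^n\times\mathbb{R}^{|\mathcal E|}$ and $\sigma=(\lambda,\omega,\alpha,\eta)\in\mathbb{R}\times\mathbb{R}^n\times\mathbb{R}^n\times\mathbb{R}^{2|\mathcal E|}$, with $\pi:=\lambda\mathbf 1-H\eta-\omega$ and $q:=\tfrac1\rho(\pi-\alpha)+\hat q$: \[ \dot{\tilde\theta}=C^T\omega,\qquad M\dot\omega=q-d-D\omega-CB\tilde\theta, \] \[ \tau^\alpha_j\dot\alpha_j=q_j-\frac{\pi_j-\bar c_j}{c_j}\ (j=1,\dots,n),\qquad T^{\hat q}\dot{\hat q}=\pi-\alpha, \] \[ T^\lambda\dot\lambda=-\mathbf 1^T(q-d),\qquad T^\eta\dot\eta=\big[H^T(q-d)-F\big]^+_\eta . \] Let $\mathbb I=\{(z,\sigma):\eta\ge0\}$ and let $\mathbb E$ be the set of equilibrium points of this system, assumed nonempty. Then $\mathbb E$ is globally asymptotically stable on $\mathbb I$; in particular, every trajectory $(z(t),\sigma(t))$ starting in $\mathbb I$ remains bounded for $t\ge0$ and converges, as $t\to\infty$, to a single equilibrium point $(z^*,\sigma^* )\in\mathbb E$.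
   Context: $(\mathcal N,\mathcal E)$ is a connected directed graph with $\mathcal N=\{1,\dots,n\}$; $C$ is its incidence matrix ($C_{j,e}=1$ if $e=(j,k)$, $-1$ if $e=(k,j)$, $0$ otherwise). $B$, $D$, $M$ are diagonal with positive diagonal entries; $T^{\hat q},T^\lambda,T^\eta$ are diagonal (or positive scalar) with positive entries, and $\tau^\alpha_j>0$. $L:=CBC^T$, $H\in\mathbb{R}^{n\times2|\mathcal E|}$ with $H^T=\begin{bmatrix} BC^TL^\dagger\\ -BC^TL^\dagger\end{bmatrix}$ ($L^\dagger$ Moore–Penrose inverse), $F=\begin{bmatrix}\overline F\\-\underline F\end{bmatrix}$, $d\in\mathbb{R}^n$ given. Projection: for vectors $y,u$, $([y]^+_u)_e=y_e$ if $y_e>0$ or $u_e>0$, and $0$ otherwise; it keeps $\eta(t)\ge0$ when $\eta(0)\ge0$. Solutions are understood in the Carathéodory sense. *)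

(* Defs.v *)
From HB Require Import structures.
From mathcomp Require Import all_boot all_order all_algebra.
From mathcomp Require Import all_classical all_reals all_analysis.
Set Implicit Arguments. Unset Strict Implicit. Unset Printing Implicit Defensive.
Import Order.TTheory GRing.Theory Num.Theory.
Import numFieldNormedType.Exports.
Local Open Scope classical_set_scope.
Local Open Scope ring_scope.

Section Defs.
Variable R : realType.

Definition no_self_loops n m (src dst : 'I_m -> 'I_n) := forall e, src e != dst e.

Definition graph_adj n m (src dst : 'I_m -> 'I_n) : rel 'I_n :=
  fun j k => [exists e, ((src e == j) && (dst e == k)) || ((src e == k) && (dst e == j))].

Definition graph_connected n m (src dst : 'I_m -> 'I_n) :=
  forall j k : 'I_n, connect (graph_adj src dst) j k.

Definition incidence n m (src dst : 'I_m -> 'I_n) : 'M[R]_(n, m) :=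
  \matrix_(j < n, e < m)
    (if src e == j then 1 else if dst e == j then -1 else 0).

Definition is_MP_inverse n (A X : 'M[R]_n) :=
  [/\ A *m X *m A = A, X *m A *m X = X, (A *m X)^T = A *m X & (X *m A)^T = X *m A].

Definition proj_plus k (y u : 'cV[R]_k) : 'cV[R]_k :=
  \col_e (if (0 < y e 0) || (0 < u e 0) then y e 0 else 0).

Definition positive_diag k (A : 'M[R]_k) :=
  (forall i j, i != j -> A i j = 0) /\ (forall i, 0 < A i i).

(* dimension of the full state (qhat, theta, lambda, omega, alpha, eta) *)
Definition sdim n m := (n + (m + (1 + (n + (n + (m + m))))))%N.

Definition mk_state n m (qh : 'cV[R]_n) (th : 'cV[R]_m) (la : R) (om al : 'cV[R]_n)
  (et : 'cV[R]_(m + m)) : 'cV[R]_(sdim n m) :=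
  col_mx qh (col_mx th (col_mx (la%:M) (col_mx om (col_mx al et)))).

Definition st_qh n m (x : 'cV[R]_(sdim n m)) : 'cV[R]_n := usubmx x.
Definition st_th n m (x : 'cV[R]_(sdim n m)) : 'cV[R]_m := usubmx (dsubmx x).
Definition st_la n m (x : 'cV[R]_(sdim n m)) : R := (usubmx (dsubmx (dsubmx x))) 0 0.
Definition st_om n m (x : 'cV[R]_(sdim n m)) : 'cV[R]_n :=
  usubmx (dsubmx (dsubmx (dsubmx x))).
Definition st_al n m (x : 'cV[R]_(sdim n m)) : 'cV[R]_n :=
  usubmx (dsubmx (dsubmx (dsubmx (dsubmx x)))).
Definition st_et n m (x : 'cV[R]_(sdim n m)) : 'cV[R]_(m + m) :=
  dsubmx (dsubmx (dsubmx (dsubmx (dsubmx x)))).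

Definition field n m (C : 'M[R]_(n, m)) (B : 'M[R]_m) (D M Tq : 'M[R]_n) (Tl : R)
  (Te : 'M[R]_(m + m)) (tau c cbar d : 'cV[R]_n) (H : 'M[R]_(n, m + m))
  (F : 'cV[R]_(m + m)) (rho : R) (x : 'cV[R]_(sdim n m)) : 'cV[R]_(sdim n m) :=
  let qh := st_qh x in let th := st_th x in let la := st_la x in
  let om := st_om x in let al := st_al x in let et := st_et x in
  let pi := la *: const_mx 1 - H *m et - om in
  let q := rho^-1 *: (pi - al) + qh in
  mk_state
    (invmx Tq *m (pi - al))
    (C^T *m om)
    (- (\sum_j (q - d) j 0) / Tl)
    (invmx M *m (q - d - D *m om - C *m B *m th))
    (\col_j ((q j 0 - (pi j 0 - cbar j 0) / c j 0) / tau j 0))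
    (invmx Te *m proj_plus (H^T *m (q - d) - F) et).

(* Caratheodory solution on [0, +oo) of x' = f(x): each coordinate of
   s |-> f (x s) is Lebesgue integrable on every [0, t] and x is the
   integral of it (equivalently, x is locally absolutely continuous with
   x' = f(x) a.e.). *)
Definition carath_sol k (f : 'cV[R]_k -> 'cV[R]_k) (x : R -> 'cV[R]_k) :=
  forall t : R, 0 <= t -> forall i : 'I_k,
    (@lebesgue_measure R).-integrable `[0, t] (fun s => ((f (x s)) i 0)%:E) /\
    x t i 0 = x 0 i 0 + Rintegral (@lebesgue_measure R) `[0, t] (fun s => (f (x s)) i 0).

Definition near_set k (E : set 'cV[R]_k) (v : 'cV[R]_k) (eps : R) :=
  exists2 e, E e & `|v - e| < eps.

Definition set_stable_on k (f : 'cV[R]_k -> 'cV[R]_k) (E I : set 'cV[R]_k) :=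
  forall eps : R, 0 < eps -> exists2 delta : R, 0 < delta &
    forall x, carath_sol f x -> I (x 0) -> near_set E (x 0) delta ->
      forall t, 0 <= t -> near_set E (x t) eps.

Definition set_attractive_on k (f : 'cV[R]_k -> 'cV[R]_k) (E I : set 'cV[R]_k) :=
  forall x, carath_sol f x -> I (x 0) ->
    forall eps : R, 0 < eps -> \forall t \near +oo, near_set E (x t) eps.

Definition GAS_on k (f : 'cV[R]_k -> 'cV[R]_k) (E I : set 'cV[R]_k) :=
  set_stable_on f E I /\ set_attractive_on f E I.

End Defs.

(* Main.v *)
Require Import Defs.
From HB Require Import structures.
From mathcomp Require Import all_boot all_order all_algebra.
From mathcomp Require Import all_classical all_reals all_analysis.
From mathcomp Require Import lra ring.
Import Order.TTheory GRing.Theory Num.Theory.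
Import numFieldNormedType.Exports.
Local Open Scope classical_set_scope.
Local Open Scope ring_scope.

(* Call an equilibrium with eta >= 0 a KKT point: it is a primal-dual optimum of
   the dispatch problem. Around any KKT point [xs] the weighted squared distance
   is a Lyapunov function whose rate is at most [- dissipation xs], and this
   dissipation is definite in (omega, pi, alpha) because rho < 4 c_j. Hence
   trajectories are bounded and, by Barbalat, the dissipation and the rates of
   alpha and omega vanish at infinity, which forces every cluster point to be a
   KKT point. Taking the cluster point itself as the centre of the Lyapunov
   function gives convergence to it.

   The set of zeros of the field also contains points with negative eta, which
   are not centres of Lyapunov functions. Splitting according to the active
   constraints, the KKT points form a finite union of polyhedra, so Hoffman's
   error bound shows that a zero of the field at distance delta from the
   half-space eta >= 0 is O(delta)-close to a KKT point. This gives set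
   stability. It also gives existence: a quadratic penalisation of the dispatch
   problem, which is feasible as soon as the field has a zero, yields arbitrarily
   good approximate KKT points. *)

(** * Hoffman's error bound *)

Lemma cvnorm_leP (R : realType) (k : nat) (v : 'cV[R]_k) (K : R) :
  0 <= K -> (forall i, `|v i 0| <= K) -> `|v| <= K.
Proof.
move=> K0 vK; rewrite /Num.norm /= mx_normrE; apply/bigmax_leP; split=> //.
by move=> [i j] _ /=; rewrite [j]ord1.
Qed.

Lemma cvnorm_coord (R : realType) (k : nat) (v : 'cV[R]_k) i : `|v i 0| <= `|v|.
Proof.
rewrite {2}/Num.norm /= mx_normrE.
exact: (le_bigmax _ (fun ij : 'I_k * 'I_1 => `|v ij.1 ij.2|) (i, 0)).
Qed.

(** The witness is the largest lower bound, clipped from below at [x - r]. This chooses the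
    eliminated variable close to its old value. *)
Lemma between_families (R : realType) (I : finType) (P Q : pred I)
    (l u : I -> R) (x r : R) : 0 <= r ->
  (forall i j, P i -> Q j -> l i <= u j) ->
  (forall i, P i -> l i <= x + r) -> (forall j, Q j -> x - r <= u j) ->
  exists z, [/\ forall i, P i -> l i <= z, forall j, Q j -> z <= u j & `|z - x| <= r].
Proof.
move=> r0 lu lx xu; exists (\big[Num.max/x - r]_(i | P i) l i); split.
- by move=> i Pi; exact: le_bigmax_cond.
- by move=> j Qj; apply/bigmax_leP; split=> [|i Pi]; [exact: xu|exact: lu].
- have h1 : \big[Num.max/x - r]_(i | P i) l i <= x + r.
    by apply/bigmax_leP; split=> //; lra.
  have h2 : x - r <= \big[Num.max/x - r]_(i | P i) l i by exact: bigmax_ge_id.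
  by rewrite ler_norml; apply/andP; split; lra.
Qed.

(** Points are sequences of which only the first [k] entries are read, so that eliminating a
    variable requires no reindexing. *)
Definition affval {R : realType} (k : nat) (g : (nat -> R) * R) (x : nat -> R) : R :=
  \sum_(j < k) g.1 j * x j + g.2.

Lemma affval_lip (R : realType) k (g : (nat -> R) * R) (x y : nat -> R) (e : R) :
  (forall j, (j < k)%N -> `|x j - y j| <= e) ->
  `|affval k g x - affval k g y| <= (\sum_(j < k) `|g.1 j|) * e.
Proof.
move=> xy; rewrite /affval opprD addrACA subrr addr0 -sumrB.
apply: (le_trans (ler_norm_sum _ _ _)); rewrite mulr_suml; apply: ler_sum => j _.
by rewrite -mulrBr normrM; apply: ler_wpM2l => //; exact: xy.
Qed.

(* Fourier-Motzkin elimination of the last variable. The statement combines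
   Hoffman's error bound with the fact that an infeasible system stays
   infeasible under small perturbations of its right-hand side. *)
Lemma hoffman_nat (R : realType) (k : nat) : forall (I : finType) (g : I -> (nat -> R) * R),
  exists K d0 : R, [/\ 0 < K, 0 < d0 & forall (d : R) x, 0 <= d -> d <= d0 ->
    (forall i, affval k (g i) x <= d) ->
    exists2 y, (forall i, affval k (g i) y <= 0) &
      forall j, (j < k)%N -> `|y j - x j| <= K * d].
Proof.
elim: k => [|k IH] I g.
  have [ok|nok] := pselect (forall i, (g i).2 <= 0).
    exists 1, 1; split=> // d x _ _ _; exists x => // i.
    by rewrite /affval big_ord0 add0r.
  (* With no variables left and a positive constant, taking half of that constant as [d0] makes the
     hypothesis on [x] contradictory. *)
  have [i gi] : exists i, 0 < (g i).2.
    apply: contrapT => h; apply: nok => i; rewrite leNgt; apply/negP => gi.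
    by apply: h; exists i.
  exists 1, ((g i).2 / 2); split=> //; first by rewrite divr_gt0.
  move=> d x _ dd /(_ i); rewrite /affval big_ord0 add0r => h.
  by exfalso; lra.
pose a i := (g i).1 k.
(* [c] dominates every [|a i|^-1 + |a j|^-1], so a combined constraint is violated by at most
   [c * d]. Being at least 1, it also covers the constraints that are kept as they are. *)
pose c := 1 + \sum_i `|a i|^-1 *+ 2.
have ainv i : `|a i|^-1 <= \sum_i `|a i|^-1.
  by rewrite (bigD1 i) //= ler_wpDr // sumr_ge0 // => j _; rewrite invr_ge0.
have sge0 : 0 <= \sum_i `|a i|^-1 by rewrite sumr_ge0 // => j _; rewrite invr_ge0.
have c_ge i j : `|a i|^-1 + `|a j|^-1 <= c.
  rewrite /c sumrMnl mulr2n; have := ainv i; have := ainv j; lra.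
have c1 : 1 <= c by rewrite /c sumrMnl mulr2n; lra.
have c0 : 0 < c by lra.
(* Constraints free of the last variable are kept, each upper bound on it is paired with each lower
   bound, and all other indices carry the trivial constraint. *)
pose g' (s : I + I * I) : (nat -> R) * R :=
  match s with
  | inl i => if a i == 0 then g i else (fun=> 0, 0)
  | inr (i, j) => if (0 < a i) && (a j < 0)
      then (fun l => (g i).1 l / a i - (g j).1 l / a j, (g i).2 / a i - (g j).2 / a j)
      else (fun=> 0, 0)
  end.
have g'0 x : affval k (fun=> 0, 0) x = 0 :> R.
  by rewrite /affval /= big1 ?addr0 // => j _; rewrite mul0r.
have g'r i j x : 0 < a i -> a j < 0 ->
    affval k (g' (inr (i, j))) x = affval k (g i) x / a i - affval k (g j) x / a j.
  move=> ai aj; rewrite /g' ai aj /= /affval /= !mulrDl opprD addrACA; congr (_ + _).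
  rewrite !mulr_suml -sumrB; apply: eq_bigr => l _; rewrite mulrBl; congr (_ - _); ring.
have gS i x : affval k.+1 (g i) x = affval k (g i) x + a i * x k.
  by rewrite /affval big_ord_recr /= addrAC.
have [K' [d0 [K'0 d00 H]]] := IH _ g'.
(* Per unit of [d]: the original violation plus the effect of moving the first [k] coordinates by
   [K' * c], divided by the coefficient of the last variable. *)
pose r1 := \sum_i (1 + (\sum_(j < k) `|(g i).1 j|) * (K' * c)) * `|a i|^-1.
have sg0 i : 0 <= \sum_(j < k) `|(g i).1 j| by rewrite sumr_ge0.
have K'c0 : 0 < K' * c by rewrite mulr_gt0.
have r1_ge i : (1 + (\sum_(j < k) `|(g i).1 j|) * (K' * c)) * `|a i|^-1 <= r1.
  rewrite /r1 (bigD1 i) //= ler_wpDr // sumr_ge0 // => j _.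
  by rewrite mulr_ge0 ?invr_ge0 // addr_ge0 // mulr_ge0 // ltW.
have r10 : 0 <= r1.
  rewrite sumr_ge0 // => j _.
  by rewrite mulr_ge0 ?invr_ge0 // addr_ge0 // mulr_ge0 // ltW.
exists (K' * c + r1), (d0 / c); split.
- by rewrite ltr_wpDr.
- by rewrite divr_gt0.
move=> d x d_ge0 dd0 gx.
have [||s|y yle yx] := H (c * d) x.
- by rewrite mulr_ge0 // ltW.
- by rewrite mulrC -ler_pdivlMr.
- case: s => [i|[i j]].
    rewrite /g'; case: eqP => [ai|_]; last by rewrite g'0 mulr_ge0 // ltW.
    have := gx i; rewrite gS ai mul0r addr0 => /le_trans; apply.
    by rewrite ler_peMl.
  case: (boolP ((0 < a i) && (a j < 0))) => [/andP[ai aj]|h]; last first.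
    by rewrite /g' (negbTE h) g'0 mulr_ge0 // ltW.
  rewrite g'r //.
  have h1 : affval k (g i) x / a i + x k <= d * `|a i|^-1.
    rewrite gtr0_norm //; have := gx i; rewrite gS => h.
    rewrite ler_pdivlMr // mulrDl divfK ?gt_eqF // mulrC; lra.
  have h2 : - (affval k (g j) x / a j) - x k <= d * `|a j|^-1.
    rewrite ltr0_norm //; have := gx j; rewrite gS => h.
    rewrite ler_pdivlMr ?oppr_gt0 //.
    have -> : (- (affval k (g j) x / a j) - x k) * - a j = affval k (g j) x + a j * x k.
      by field; rewrite lt_eqF.
    lra.
  have := ler_wpM2l d_ge0 (c_ge i j); rewrite mulrDr (mulrC c); lra.
have est i : `|affval k (g i) y - affval k (g i) x| + d <=
    (1 + (\sum_(j < k) `|(g i).1 j|) * (K' * c)) * d.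
  have := @affval_lip R k (g i) y x (K' * c * d) _.
  rewrite mulrDl mul1r -[in X in _ -> _ <= X]mulrA => h; rewrite [leRHS]addrC.
  by rewrite lerD2r; apply: h => j jk; rewrite -mulrA; exact: yx.
have r1d i : (1 + (\sum_(j < k) `|(g i).1 j|) * (K' * c)) * d * `|a i|^-1 <= r1 * d.
  by rewrite mulrAC; apply: ler_wpM2r.
(* The new last coordinate must respect lower bounds (negative [a i]) and upper bounds (positive
   [a i]). The paired constraints are exactly their compatibility. *)
have := @between_families R I (fun i => a i < 0) (fun i => 0 < a i)
  (fun i => - (affval k (g i) y / a i)) (fun i => - (affval k (g i) y / a i))
  (x k) (r1 * d).
case.
- by rewrite mulr_ge0.
- move=> j i aj ai; have := yle (inr (i, j)); rewrite g'r //; lra.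
- move=> i ai; have := gx i; rewrite gS => gxi.
  suff : - (affval k (g i) y / a i) - x k <= r1 * d by lra.
  apply: le_trans (r1d i); rewrite ltr0_norm // ler_pdivlMr ?oppr_gt0 //.
  have -> : (- (affval k (g i) y / a i) - x k) * - a i = affval k (g i) y + a i * x k.
    by field; rewrite lt_eqF.
  apply: le_trans (est i).
  have := ler_norm (affval k (g i) y - affval k (g i) x); lra.
- move=> i ai; have := gx i; rewrite gS => gxi.
  suff : (affval k (g i) y / a i) + x k <= r1 * d by lra.
  apply: le_trans (r1d i); rewrite gtr0_norm // ler_pdivlMr //.
  have -> : ((affval k (g i) y / a i) + x k) * a i = affval k (g i) y + a i * x k.
    by field; rewrite gt_eqF.
  apply: le_trans (est i).
  have := ler_norm (affval k (g i) y - affval k (g i) x); lra.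
move=> z [zl zu zx].
pose y' j := if j == k then z else y j.
have y'lt j : (j < k)%N -> y' j = y j by move=> jk; rewrite /y' ltn_eqF.
have vy' i : affval k (g i) y' = affval k (g i) y.
  by rewrite /affval; congr (_ + _); apply: eq_bigr => j _; rewrite y'lt.
have y'k : y' k = z by rewrite /y' eqxx.
exists y'.
  move=> i; rewrite gS vy' y'k.
  have [ai|ai|ai] := ltgtP (a i) 0.
  - have := zl i ai; rewrite lerNl ler_ndivlMr //; lra.
  - have := zu i ai; rewrite lerNr ler_pdivrMr //; lra.
  - by have := yle (inl i); rewrite /g' ai eqxx mul0r addr0.
move=> j; rewrite ltnS leq_eqVlt => /orP[/eqP ->|jk].
  rewrite y'k (le_trans zx) // ler_wpM2r //; lra.
rewrite y'lt // (le_trans (yx j jk)) // mulrA ler_wpM2r //; lra.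
Qed.

(** * Affine and locally Lipschitz functions *)

Definition affine {R : realType} {k} (g : 'cV[R]_k -> R) :=
  exists (a : 'I_k -> R) (b : R), forall x, g x = \sum_i a i * x i 0 + b.

Section AffineClosure.
Context {R : realType} {k : nat}.
Implicit Types g h : 'cV[R]_k -> R.

Lemma affine_ext g h : g =1 h -> affine g -> affine h.
Proof. by move=> gh [a [b gE]]; exists a, b => x; rewrite -gh. Qed.

Lemma affine_cst (r : R) : affine (fun _ : 'cV[R]_k => r).
Proof. by exists (fun=> 0), r => x; rewrite big1 ?add0r // => i _; rewrite mul0r. Qed.

Lemma affine_coord i : affine (fun x : 'cV[R]_k => x i 0).
Proof.
exists (fun j => (j == i)%:R), 0 => x; rewrite addr0 (bigD1 i) //= eqxx mul1r.
by rewrite big1 ?addr0 // => j /negbTE ->; rewrite mul0r.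
Qed.

Lemma affineD g h : affine g -> affine h -> affine (fun x => g x + h x).
Proof.
move=> [a [b gE]] [a' [b' hE]]; exists (fun i => a i + a' i), (b + b') => x.
rewrite gE hE addrACA -big_split /=; congr (_ + _).
by apply: eq_bigr => i _; rewrite mulrDl.
Qed.

Lemma affineZ (r : R) g : affine g -> affine (fun x => r * g x).
Proof.
move=> [a [b gE]]; exists (fun i => r * a i), (r * b) => x.
rewrite gE mulrDr mulr_sumr; congr (_ + _).
by apply: eq_bigr => i _; rewrite mulrA.
Qed.

Lemma affineN g : affine g -> affine (fun x => - g x).
Proof. by move/(affineZ (-1)); apply: affine_ext => x; rewrite mulN1r. Qed.

Lemma affineB g h : affine g -> affine h -> affine (fun x => g x - h x).
Proof. by move=> ag ah; apply: affineD ag (affineN _ ah). Qed.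

Lemma affine_divr (r : R) g : affine g -> affine (fun x => g x / r).
Proof. by move/(affineZ r^-1); apply: affine_ext => x; rewrite mulrC. Qed.

Lemma affine_sum (I : Type) (s : seq I) (G : I -> 'cV[R]_k -> R) :
  (forall i, affine (G i)) -> affine (fun x => \sum_(i <- s) G i x).
Proof.
move=> aG; elim: s => [|i s IH].
  by apply: affine_ext (affine_cst 0) => x; rewrite big_nil.
by apply: affine_ext (affineD _ _ (aG i) IH) => x; rewrite big_cons.
Qed.

Lemma affine_mulmx p q (A : 'M[R]_(p, q)) (v : 'cV[R]_k -> 'cV[R]_q) i :
  (forall j, affine (fun x => v x j 0)) -> affine (fun x => (A *m v x) i 0).
Proof.
move=> av; apply: (@affine_ext (fun x => \sum_j A i j * v x j 0)).
  by move=> x; rewrite mxE.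
by apply: affine_sum => j; apply: affineZ.
Qed.

End AffineClosure.

(** A single affine system read at all right-hand sides: [P 0] is the polyhedron, and [P d] allows
    each constraint a violation of [d]. *)
Definition polyfam {R : realType} {k} (P : R -> set 'cV[R]_k) :=
  exists (I : finType) (g : I -> 'cV[R]_k -> R),
    (forall i, affine (g i)) /\ (forall d x, P d x <-> forall i, g i x <= d).

Section PolyFam.
Context {R : realType} {k : nat}.
Implicit Types P Q : R -> set 'cV[R]_k.

Lemma polyfam_le (g : 'cV[R]_k -> R) : affine g -> polyfam (fun d x => g x <= d).
Proof. by move=> ag; exists unit, (fun=> g); split=> // d x; split=> // /(_ tt). Qed.

Lemma polyfam_and P Q : polyfam P -> polyfam Q -> polyfam (fun d x => P d x /\ Q d x).
Proof.
move=> [I [g [ag Pg]]] [J [h [ah Qh]]].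
exists (I + J)%type, (fun s => match s with inl i => g i | inr j => h j end); split.
  by case.
move=> d x; split=> [[/Pg Pd /Qh Qd] [i|j]//|H].
by split; [apply/Pg => i; exact: (H (inl i))|apply/Qh => j; exact: (H (inr j))].
Qed.

Lemma polyfam_all (I : finType) (P : I -> R -> set 'cV[R]_k) :
  (forall i, polyfam (P i)) -> polyfam (fun d x => forall i, P i d x).
Proof.
move=> pP.
(* The index type depends on [i], so it is extracted as data and the joint system is indexed by
   dependent pairs. *)
have pP' i : {J : finType & {g : J -> 'cV[R]_k -> R | (forall j, affine (g j)) /\
    (forall d x, P i d x <-> forall j, g j x <= d)}}.
  by have /cid[J /cid[g H]] := pP i; exists J, g.
exists {i : I & projT1 (pP' i)}, (fun s => sval (projT2 (pP' (tag s))) (tagged s)).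
split; first by case=> i j /=; case: (svalP (projT2 (pP' i))) => + _; exact.
move=> d x; split.
  move=> Pd [i j] /=; case: (svalP (projT2 (pP' i))) => _ H.
  by have /H := Pd i; exact.
move=> H i; case: (svalP (projT2 (pP' i))) => _ /(_ d x) ->.
by move=> j; exact: (H (existT _ i j)).
Qed.

Lemma polyfam_norm (g : 'cV[R]_k -> R) : affine g -> polyfam (fun d x => `|g x| <= d).
Proof.
move=> ag; have [I [h [ah H]]] := polyfam_and _ _ (polyfam_le _ ag) (polyfam_le _ (affineN _ ag)).
exists I, h; split=> // d x; rewrite -H ler_norml lerNl.
by split=> [/andP[]|[-> ->]].
Qed.

Lemma hoffman P : polyfam P ->
  exists K d0 : R, [/\ 0 < K, 0 < d0 & forall d x, 0 <= d -> d <= d0 ->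
    P d x -> exists2 y, P 0 y & `|y - x| <= K * d].
Proof.
move=> [I [g [ag Pg]]].
have /choice[ab abE] : forall i, exists ab : ('I_k -> R) * R,
    forall x, g i x = \sum_j ab.1 j * x j 0 + ab.2.
  by move=> i; have [a [b gE]] := ag i; exists (a, b).
(* The default 0 beyond index [k] is never read by [affval k]. *)
pose ext (a : 'I_k -> R) (j : nat) : R := oapp a 0 (insub j).
have extE a (j : 'I_k) : ext a j = a j by rewrite /ext valK.
have [K [d0 [K0 d00 H]]] := hoffman_nat R k _ (fun i => (ext (ab i).1, (ab i).2)).
exists K, d0; split=> // d x dge0 dd0 /Pg Pd.
have vE i y : affval k (ext (ab i).1, (ab i).2) y = g i (\col_j y j).
  rewrite abE /affval /=; congr (_ + _); apply: eq_bigr => j _.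
  by rewrite extE mxE.
have [//|i|y yle yx] := H d (ext (fun j => x j 0)) dge0.
  rewrite vE; have -> : (\col_j ext (fun j => x j 0) j) = x; last exact: Pd.
  by apply/matrixP => a b; rewrite mxE extE [b]ord1.
exists (\col_j y j); first by apply/Pg => i; rewrite -vE.
apply: cvnorm_leP; first by rewrite mulr_ge0 // ltW.
by move=> j; rewrite !mxE; have := yx j (ltn_ord j); rewrite extE.
Qed.

End PolyFam.

(** Lipschitz continuity is asked on balls only, which makes the class stable under products and so
    contains the quadratic dissipation. *)
Definition llip {R : realType} {k} (g : 'cV[R]_k -> R) :=
  forall r : R, exists2 K : R, 0 <= K &
    forall x y, `|x| <= r -> `|y| <= r -> `|g x - g y| <= K * `|x - y|.

Section Llip.
Context {R : realType} {k : nat}.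
Implicit Types g h : 'cV[R]_k -> R.

Lemma llip_bounded g : llip g ->
  forall r : R, exists2 K : R, 0 <= K & forall x, `|x| <= r -> `|g x| <= K.
Proof.
move=> lg r; have [K K0 H] := lg r.
exists (K * `|r| + `|g 0|) => [|x xr]; first by rewrite addr_ge0 // mulr_ge0.
have r0 : 0 <= r by exact: le_trans xr.
have := H x 0 xr; rewrite normr0 => /(_ r0); rewrite subr0 => h.
have := ler_normD (g x - g 0) (g 0); rewrite subrK => h2.
have := ler_wpM2l K0 xr; rewrite (ger0_norm r0); lra.
Qed.

Lemma affine_llip g : affine g -> llip g.
Proof.
move=> [a [b gE]] r; exists (\sum_i `|a i|) => [|x y _ _]; first by rewrite sumr_ge0.
rewrite !gE opprD addrACA subrr addr0 -sumrB mulr_suml.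
apply: (le_trans (ler_norm_sum _ _ _)); apply: ler_sum => i _.
rewrite -mulrBr normrM; apply: ler_wpM2l => //.
by have := cvnorm_coord _ _ (x - y) i; rewrite !mxE.
Qed.

Lemma llip_ext g h : g =1 h -> llip g -> llip h.
Proof. by move=> gh lg r; have [K K0 H] := lg r; exists K => // x y; rewrite -!gh; exact: H. Qed.

Lemma llip_cst (c : R) : llip (fun _ : 'cV[R]_k => c).
Proof. exact/affine_llip/affine_cst. Qed.

Lemma llipD g h : llip g -> llip h -> llip (fun x => g x + h x).
Proof.
move=> lg lh r; have [K K0 H] := lg r; have [K' K'0 H'] := lh r.
exists (K + K') => [|x y xr yr]; first exact: addr_ge0.
rewrite opprD addrACA mulrDl; apply: (le_trans (ler_normD _ _)).
by apply: lerD; [exact: H|exact: H'].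
Qed.

Lemma llipM g h : llip g -> llip h -> llip (fun x => g x * h x).
Proof.
move=> lg lh r; have [K K0 H] := lg r; have [K' K'0 H'] := lh r.
have [G G0 HG] := llip_bounded _ lg r; have [G' G'0 HG'] := llip_bounded _ lh r.
exists (G * K' + G' * K) => [|x y xr yr]; first by rewrite addr_ge0 // mulr_ge0.
have -> : g x * h x - g y * h y = g x * (h x - h y) + h y * (g x - g y) by ring.
apply: (le_trans (ler_normD _ _)); rewrite !normrM mulrDl -!mulrA.
by apply: lerD; apply: ler_pM => //; [exact: HG|exact: H'|exact: HG'|exact: H].
Qed.

Lemma llipZ (c : R) g : llip g -> llip (fun x => c * g x).
Proof. exact: llipM (llip_cst c). Qed.

Lemma llipN g : llip g -> llip (fun x => - g x).
Proof. by move/(llipZ (-1)); apply: llip_ext => x; rewrite mulN1r. Qed.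

Lemma llip_sqr g : llip g -> llip (fun x => g x ^+ 2).
Proof. by move=> lg; apply: llip_ext (llipM _ _ lg lg) => x; rewrite expr2. Qed.

Lemma llip_sum (I : Type) (s : seq I) (G : I -> 'cV[R]_k -> R) :
  (forall i, llip (G i)) -> llip (fun x => \sum_(i <- s) G i x).
Proof.
move=> aG; elim: s => [|i s IH].
  by apply: llip_ext (llip_cst 0) => x; rewrite big_nil.
by apply: llip_ext (llipD _ _ (aG i) IH) => x; rewrite big_cons.
Qed.

Lemma llip_max0 g : llip g -> llip (fun x => Num.max (g x) 0).
Proof.
move=> lg r; have [K K0 H] := lg r; exists K => // x y xr yr.
apply: le_trans (H x y xr yr).
have := ler_norm (g x - g y); have := ler_norm (g y - g x); rewrite (distrC (g y)) => h1 h2.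
have := normr_ge0 (g x - g y) => h3.
by rewrite ler_norml !maxElt; apply/andP; split; do 2 case: ltP => ?; lra.
Qed.

(** Along an ultrafilter finer than [F], each coordinate converges by compactness of the segment
    from [-K] to [K], and there are finitely many coordinates. *)
Lemma cluster_point (T : Type) (F : set_system T) (u : T -> 'cV[R]_k) (K : R) :
  ProperFilter F -> F [set t | `|u t| <= K] ->
  exists l, forall (e : R) (A : set T), 0 < e -> F A -> exists2 t, A t & `|u t - l| < e.
Proof.
move=> PF FK; have [G [UG FG]] := ultraFilterLemma PF.
have cvg_i (i : 'I_k) : exists l : R, (fun t => u t i 0) @ G --> l.
  have [|l [_ Hl]] := @segment_compact R (- K) K ((fun t => u t i 0) @ G) _.
    suff : G [set t | - K <= u t i 0 <= K] by [].
    apply: filterS (FG _ FK) => t /= tK; rewrite -ler_norml.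
    exact: le_trans (cvnorm_coord _ _ _ _) tK.
  exists l => N lN; have [//|GN] := in_ultra_setVsetC ((fun t => u t i 0) @^-1` N) UG.
  by have [r []] := Hl (~` N) N GN lN.
have [l lP] := choice cvg_i; exists (\col_i l i) => e A e0 FA.
have : \forall t \near G, forall i : 'I_k, `|u t i 0 - l i| <= e / 2.
  apply: filter_forall => i; have /cvgrPdist_le := lP i.
  move=> /(_ (e / 2)); rewrite divr_gt0 // => /(_ isT); apply: filterS => t.
  by rewrite distrC.
move=> Gl; have [t [At tl]] := @filter_ex _ G _ _ (filterI (FG _ FA) Gl).
exists t => //; apply: (@le_lt_trans _ _ (e / 2)); last by lra.
by apply: cvnorm_leP => [|i]; [lra|rewrite !mxE; exact: tl].
Qed.

(** A minimising sequence below the level of [x0] stays in a ball; any of its cluster points attains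
    the infimum. *)
Lemma coercive_min (P : 'cV[R]_k -> R) (x0 : 'cV[R]_k) (K : R) : llip P ->
  (forall x, P x <= P x0 -> `|x| <= K) -> exists x, forall y, P x <= P y.
Proof.
move=> lP co.
have [b b0 Pb] := llip_bounded _ lP K.
have Pinf : has_inf (range P).
  split; first by exists (P x0), x0.
  exists (- b) => _ [x _ <-]; case: (leP (P x) (P x0)) => [/co/Pb|h].
    by rewrite ler_norml => /andP[].
  by have /Pb := co x0 (lexx _); rewrite ler_norml => /andP[? _]; lra.
(* Once [x0] is known not to be a minimiser, the infimum lies strictly below [P x0] and the sequence
   can be chosen strictly below that level. *)
have [ok|nok] := pselect (forall y, P x0 <= P y); first by exists x0.
have [x1 x1lt] : exists x1, P x1 < P x0.
  apply: contrapT => h; apply: nok => y; rewrite leNgt; apply/negP => hy.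
  by apply: h; exists y.
have infle y : inf (range P) <= P y by apply: ge_inf; [case: Pinf|exists y].
have /choice[u uP] : forall n : nat, exists x, P x < Num.min (inf (range P) + n.+1%:R^-1) (P x0).
  move=> n; have := @inf_adherent R (range P)
    (Num.min (inf (range P) + n.+1%:R^-1) (P x0) - inf (range P)).
  case=> //.
    rewrite subr_gt0 lt_min ltrDl invr_gt0 ltr0n /=.
    exact: le_lt_trans (infle x1) x1lt.
  by move=> _ [x _ <-]; rewrite addrC subrK => h; exists x.
have uK n : `|u n| <= K.
  by apply/co/ltW; have := uP n; rewrite lt_min => /andP[].
have [|l Hl] := @cluster_point nat \oo u K _; first by near=> n => /=; exact: uK.
exists l => y; apply: le_trans (infle y).
have [L L0 HL] := lP (`|l| + K + 1).
apply/ler_addgt0Pr => e e0.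
have K0 : 0 <= K by exact: le_trans (uK 0%N).
have A : \forall n \near \oo, n.+1%:R^-1 < e / 2 :> R.
  have := @cvg_harmonic R => /cvgrPdist_lt /(_ (e / 2)).
  rewrite divr_gt0 // => /(_ isT); apply: filterS => n /=.
  by rewrite distrC subr0 ger0_norm // invr_ge0.
have [|n nlt nl] := Hl (e / 2 / (L + 1)) _ _ A; first by rewrite !divr_gt0 //; lra.
have : `|P l - P (u n)| <= L * `|u n - l|.
  by rewrite (distrC _ l); apply: HL; have := uK n; have := normr_ge0 l; lra.
have : L * `|u n - l| <= e / 2.
  apply: (@le_trans _ _ ((L + 1) * `|u n - l|)); first by rewrite ler_wpM2r //; lra.
  by rewrite mulrC -ler_pdivlMr ?(ltW nl) //; lra.
have := uP n; rewrite lt_min => /andP[h1 _].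
move: nlt => /= nlt h2 h3; have h4 := ler_norm (P l - P (u n)).
move: (n.+1%:R^-1) h1 nlt => z h1 nlt; move: (`|P l - P (u n)|) h3 h4 => w h3 h4; lra.
Unshelve. all: by end_near.
Qed.

End Llip.

(** * Caratheodory solutions *)

Lemma Rintegral_lincomb (d : measure_display) (T : measurableType d) (R : realType)
    (mu : {measure set T -> \bar R}) (A : set T) (I : Type) (s : seq I)
    (a : I -> R) (h : I -> T -> R) : measurable A ->
  (forall i, mu.-integrable A (EFin \o h i)) ->
  mu.-integrable A (EFin \o (fun r => \sum_(i <- s) a i * h i r)) /\
  Rintegral mu A (fun r => \sum_(i <- s) a i * h i r) =
  \sum_(i <- s) a i * Rintegral mu A (h i).
Proof.
move=> mA ih; elim: s => [|i s [IH1 IH2]].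
  under [X in EFin \o X]eq_fun do rewrite big_nil.
  under eq_Rintegral do rewrite big_nil.
  by rewrite Rintegral_cst // mul0r big_nil; split=> //; exact: integrable0.
have ahi : mu.-integrable A (EFin \o (fun r => a i * h i r)).
  exact: integrableZl (ih i).
have sumE : (fun r => \sum_(j <- i :: s) a j * h j r) =
    (fun r => a i * h i r + \sum_(j <- s) a j * h j r).
  by apply/funext => r; rewrite big_cons.
split; first by rewrite sumE; have := integrableD mA ahi IH1; exact: eq_integrable.
by rewrite sumE RintegralD // RintegralZl // IH2 big_cons.
Qed.

(** Each bisection keeps the linear term and halves the total quadratic error, which therefore
    vanishes in the limit. *)
Lemma halving_decr (R : realType) (U : R -> R) (a b c K : R) : a <= b ->
  (forall s t, a <= s -> s <= t -> t <= b ->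
     U t - U s <= c * (t - s) + K * (t - s) ^+ 2) ->
  U b - U a <= c * (b - a).
Proof.
move=> ab H.
have {}H n : forall s t, a <= s -> s <= t -> t <= b ->
    U t - U s <= c * (t - s) + K * (t - s) ^+ 2 / 2 ^+ n.
  elim: n => [|n IH] s t as_ st tb; first by rewrite expr0 divr1; exact: H.
  pose u := (s + t) / 2.
  have := IH s u; have := IH u t; rewrite /u => /(_ _ _ tb) h2 /(_ as_) h1.
  have /h2 {}h2 : a <= (s + t) / 2 by lra.
  have /h2 {}h2 : (s + t) / 2 <= t by lra.
  have /h1 {}h1 : s <= (s + t) / 2 by lra.
  have /h1 {}h1 : (s + t) / 2 <= b by lra.
  have -> : c * (t - s) + K * (t - s) ^+ 2 / 2 ^+ n.+1 =
      (c * (t - (s + t) / 2) + K * (t - (s + t) / 2) ^+ 2 / 2 ^+ n) +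
      (c * ((s + t) / 2 - s) + K * ((s + t) / 2 - s) ^+ 2 / 2 ^+ n).
    have : (2 : R) ^+ n != 0 by rewrite expf_neq0.
    by rewrite [2 ^+ n.+1]exprS; move: (2 ^+ n) => z z0; field.
  lra.
apply/ler_addgt0Pr => e e0.
(* The inequality [N < 2 ^ N] makes this many bisections enough to bring the error below [e]. *)
pose N := Num.truncn (`|K * (b - a) ^+ 2| / e).
have := H N a b (lexx _) ab (lexx _); move/le_trans; apply; rewrite lerD2l.
apply: (@le_trans _ _ (`|K * (b - a) ^+ 2| / 2 ^+ N)).
  by rewrite ler_wpM2r ?invr_ge0 ?exprn_ge0 // ler_norm.
rewrite ler_pdivrMr ?exprn_gt0 // [leRHS]mulrC -ler_pdivrMr //.
have h : 0 <= `|K * (b - a) ^+ 2| / e by rewrite divr_ge0 // ltW.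
have /andP[_ /ltW h1] := truncn_itv h.
apply: (le_trans h1); rewrite -natrX ler_nat.
exact: ltn_expl.
Qed.

(** Since [h] cannot fall faster than at rate [L], a value at least [e] keeps it above [e / 2] for a
    time [p], during which [U] gains [e / 2 * p]. Convergence of [U] excludes this at late times. *)
Lemma barbalat (R : realType) (h U : R -> R) (L l : R) : 0 <= L ->
  (forall s t, 0 <= s -> s <= t -> h s - h t <= L * (t - s)) ->
  (forall e a b, 0 < e -> 0 <= a -> a <= b -> (forall r, a <= r -> r <= b -> e <= h r) ->
     e * (b - a) <= U b - U a) ->
  U t @[t --> +oo] --> l ->
  forall e, 0 < e -> \forall t \near +oo, h t < e.
Proof.
move=> L0 hL hU Ul e e0.
pose p := e / 2 / (L + 1).
have p0 : 0 < p by rewrite !divr_gt0 //; lra.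
(* Two values of [U] this close to [l] differ by less than half of the gain [e / 2 * p]. *)
have d0 : 0 < e / 2 * p / 4 by rewrite divr_gt0 // mulr_gt0 //; lra.
have : \forall t \near +oo, `|l - U t| < e / 2 * p / 4.
  by have /cvgrPdist_lt := Ul; apply.
move=> [T [Treal HT]].
exists (Num.max T 0); split; first by rewrite num_real.
move=> t; rewrite gt_max => /andP[Tt t0]; rewrite ltNge; apply/negP => het.
have := hU (e / 2) t (t + p) _ (ltW t0) _ _.
have h1 := HT t Tt; have h2 : `|l - U (t + p)| < e / 2 * p / 4 by apply: HT; lra.
move=> H; have : e / 2 * (t + p - t) <= U (t + p) - U t.
  apply: H; [lra|lra|] => r tr rp.
  have := hL t r (ltW t0) tr.
  have : L * (r - t) <= (L + 1) * p by rewrite ler_pM //; lra.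
  by rewrite [X in _ <= X]mulrC divfK; [lra|rewrite gt_eqF //; lra].
rewrite [t + p]addrC addrK.
move: h1 h2; rewrite !ltr_norml [t + p]addrC; lra.
Qed.

Section Caratheodory.
Context {R : realType} {k : nat}.
Variables (f : 'cV[R]_k -> 'cV[R]_k) (x : R -> 'cV[R]_k).
Hypothesis solx : carath_sol f x.
Local Notation mu := (@lebesgue_measure R).

(** A mean value inequality for linear functionals of the state. Together with [carath_bounded], it
    is the only place where the integral form of the equation is used. *)
Lemma carath_mv (a : 'I_k -> R) (b s t : R) : 0 <= s -> s <= t ->
  (forall r, s <= r -> r <= t -> \sum_i a i * f (x r) i 0 <= b) ->
  \sum_i a i * (x t i 0 - x s i 0) <= b * (t - s).
Proof.
move=> s0 st H; have t0 : 0 <= t by lra.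
have int_i i : mu.-integrable `]s, t] (EFin \o (fun r => f (x r) i 0)).
  have [+ _] := solx _ t0 i; apply: integrableS => //.
  by apply: subset_itvr; rewrite bnd_simp.
have [i1 i2] := Rintegral_lincomb _ _ _ mu `]s, t]%classic _ (index_enum _) a
  (fun i r => f (x r) i 0) (measurable_itv _) int_i.
have -> : \sum_i a i * (x t i 0 - x s i 0) =
    Rintegral mu `]s, t] (fun r => \sum_i a i * f (x r) i 0).
  rewrite i2; apply: eq_bigr => i _; congr (_ * _).
  have [+ ->] := solx _ t0 i; have [_ ->] := solx _ s0 i => it.
  by rewrite opprD addrACA subrr add0r; apply: Rintegral_itvB; rewrite ?bnd_simp.
have -> : b * (t - s) = Rintegral mu `]s, t] (fun=> b).
  rewrite Rintegral_cst //= lebesgue_measure_itv /= lte_fin.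
  by case: (ltP s t) => [//|ts]; rewrite (_ : t = s) ?subrr; [|lra].
apply: le_Rintegral => //.
  have : mu.-integrable `[s, t] (EFin \o cst b).
    apply: continuous_compact_integrable; first exact: segment_compact.
    by apply: continuous_subspaceT => r; exact: cvg_cst.
  by apply: integrableS => //; apply: subset_itv_oc_cc.
by move=> r /=; rewrite in_itv /= => /andP[sr rt]; apply: H => //; exact: ltW.
Qed.

(** Integrability of the field along the solution bounds each coordinate on a finite interval,
    without any growth condition on [f]. *)
Lemma carath_bounded (T : R) : exists K, forall t, 0 <= t -> t <= T -> `|x t| <= K.
Proof.
pose J i := Rintegral mu `[0, T] (fun r => `|f (x r) i 0|).
exists (\sum_i (`|x 0 i 0| + J i)) => t t0 tT.
have T0 : 0 <= T by lra.
have J_ge i : `|x t i 0| <= `|x 0 i 0| + J i.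
  have [it xt] := solx _ t0 i; have [iT _] := solx _ T0 i.
  rewrite xt (le_trans (ler_normD _ _)) // lerD2l.
  apply: (le_trans (le_normr_Rintegral _ _)) => //.
  rewrite -subr_ge0 Rintegral_itvB ?bnd_simp //; last exact: integrable_norm iT.
  by apply: Rintegral_ge0.
have JJ i : 0 <= `|x 0 i 0| + J i by apply: le_trans (J_ge i).
apply: cvnorm_leP => [|i]; first by rewrite sumr_ge0.
by rewrite (le_trans (J_ge i)) // (bigD1 i) //= ler_wpDr // sumr_ge0.
Qed.

Lemma carath_coord_lip (F s t : R) i : 0 <= s -> s <= t ->
  (forall r, s <= r -> r <= t -> `|f (x r)| <= F) -> `|x t i 0 - x s i 0| <= F * (t - s).
Proof.
move=> s0 st HF.
have one (e : R) (v : 'I_k -> R) : \sum_j (if j == i then e else 0) * v j = e * v i.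
  rewrite (bigD1 i) //= eqxx big1 ?addr0 // => j /negbTE ->; exact: mul0r.
have fF r : s <= r -> r <= t -> `|f (x r) i 0| <= F.
  by move=> sr rt; apply: le_trans (cvnorm_coord _ _ _ _) (HF r sr rt).
rewrite ler_norml; apply/andP; split.
  have := carath_mv (fun j => if j == i then -1 else 0) F s t s0 st.
  rewrite one lerNl mulN1r; apply => r sr rt; rewrite one mulN1r lerNl.
  by have := fF r sr rt; rewrite ler_norml => /andP[].
have := carath_mv (fun j => if j == i then 1 else 0) F s t s0 st.
rewrite one mul1r; apply => r sr rt; rewrite one mul1r.
by have := fF r sr rt; rewrite ler_norml => /andP[].
Qed.

Lemma carath_lip (F s t : R) : 0 <= s -> s <= t ->
  (forall r, s <= r -> r <= t -> `|f (x r)| <= F) -> `|x t - x s| <= F * (t - s).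
Proof.
move=> s0 st HF; apply: cvnorm_leP => [|i].
  rewrite mulr_ge0 ?subr_ge0 //; exact: le_trans (HF s (lexx _) st).
by rewrite !mxE; exact: carath_coord_lip.
Qed.

Hypothesis fbb : forall r : R, exists F, forall y, `|y| <= r -> `|f y| <= F.

(* The second-order remainders produced by freezing the gradient at the left
   endpoint vanish under subdivision, so no chain rule is needed. *)
Lemma carath_lyapunov (U : 'cV[R]_k -> R) (G : 'I_k -> 'cV[R]_k -> R) (KU a b c : R) :
  (forall i, llip (G i)) -> 0 <= KU ->
  (forall y z, U z - U y <= \sum_i G i y * (z i 0 - y i 0) + KU * `|z - y| ^+ 2) ->
  0 <= a -> a <= b ->
  (forall r, a <= r -> r <= b -> \sum_i G i (x r) * f (x r) i 0 <= c) ->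
  U (x b) - U (x a) <= c * (b - a).
Proof.
move=> lG KU0 UG a0 ab H.
have [r0 xr0] := carath_bounded b; have [F fF] := fbb r0.
have fF' r : 0 <= r -> r <= b -> `|f (x r)| <= F by move=> *; exact/fF/xr0.
have F0 : 0 <= F by apply: le_trans (fF' a a0 ab).
have /choice[L HL] : forall i, exists L : R, 0 <= L /\ forall y z,
    `|y| <= r0 -> `|z| <= r0 -> `|G i y - G i z| <= L * `|y - z|.
  by move=> i; have [L] := lG i r0; exists L.
(* The first constant accounts for the variation of the gradient along the path, the second for the
   Taylor remainder of [U]. *)
apply: (@halving_decr R (U \o x) a b c ((\sum_i L i) * F * F + KU * F ^+ 2) ab).
move=> s t as_ st tb /=.
have s0 : 0 <= s by lra.
have xl r : s <= r -> r <= t -> `|x r - x s| <= F * (r - s).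
  by move=> sr rt; apply: carath_lip => // r' h1 h2; apply: fF'; lra.
apply: (le_trans (UG _ _)).
have : \sum_i G i (x s) * (x t i 0 - x s i 0) <=
    (c + (\sum_i L i) * F * F * (t - s)) * (t - s).
  apply: carath_mv => // r sr rt.
  have -> : \sum_i G i (x s) * f (x r) i 0 =
     \sum_i G i (x r) * f (x r) i 0 + \sum_i (G i (x s) - G i (x r)) * f (x r) i 0.
    by rewrite -big_split /=; apply: eq_bigr => i _; rewrite -mulrDl addrC subrK.
  apply: lerD; first by apply: H; lra.
  rewrite -!mulrA mulr_suml; apply: ler_sum => i _.
  have [Li0 /(_ (x s) (x r)) HLi] := HL i.
  apply: (le_trans (ler_norm _)); rewrite normrM.
  apply: (@le_trans _ _ (L i * (F * (t - s)) * F)); last first.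
    by rewrite le_eqVlt; apply/orP; left; apply/eqP; ring.
  apply: ler_pM => //; last first.
    by apply: (le_trans (cvnorm_coord _ _ _ _)); apply: fF'; lra.
  apply: (le_trans (HLi _ _)); [apply: xr0; lra|apply: xr0; lra|].
  rewrite ler_wpM2l // distrC (le_trans (xl _ sr rt)) // ler_wpM2l //; lra.
have : KU * `|x t - x s| ^+ 2 <= KU * (F * (t - s)) ^+ 2.
  by rewrite ler_wpM2l // lerXn2r ?nnegrE ?mulr_ge0 ?subr_ge0 //; exact: xl.
rewrite exprMn; lra.
Qed.

End Caratheodory.

(** * Long-time behaviour of bounded solutions *)

Section LongTime.
Context {R : realType} {k : nat}.
Variables (f : 'cV[R]_k -> 'cV[R]_k) (x : R -> 'cV[R]_k).
Hypothesis solx : carath_sol f x.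
Hypothesis fbb : forall r : R, exists F, forall y, `|y| <= r -> `|f y| <= F.
Variable K : R.
Hypothesis xK : forall t, 0 <= t -> `|x t| <= K.

Lemma bounded_sol_lip (h : 'cV[R]_k -> R) : llip h -> exists2 L : R, 0 <= L &
  forall s t, 0 <= s -> s <= t -> `|h (x s) - h (x t)| <= L * (t - s).
Proof.
move=> lh; have [L L0 HL] := lh K; have [F HF] := fbb K.
have F0 : 0 <= F by apply: le_trans (HF _ (xK _ (lexx _))).
exists (L * F) => [|s t s0 st]; first exact: mulr_ge0.
have t0 : 0 <= t by lra.
apply: (le_trans (HL _ _ (xK _ s0) (xK _ t0))); rewrite -mulrA ler_wpM2l // distrC.
by apply: (carath_lip f x solx) => // r sr rt; apply/HF/xK; lra.
Qed.

(** The rate of a convergent coordinate tends to zero: Barbalat is applied to the rate and to its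
    opposite. The square is the form that [cluster_le0] takes to the limit. *)
Lemma coord_barbalat (i : 'I_k) (h : 'cV[R]_k -> R) (l : R) : llip h ->
  (forall y, f y i 0 = h y) -> x t i 0 @[t --> +oo] --> l ->
  forall e : R, 0 < e -> \forall t \near +oo, h (x t) ^+ 2 < e.
Proof.
move=> lh fh xl e e0.
have [L L0 HL] := bounded_sol_lip _ lh.
(* Capping at 1 gives [h ^+ 2 <= |h| < q <= e]. *)
pose q := Num.min 1 e.
have q0 : 0 < q by rewrite lt_min ltr01.
have one (w : R) (v : 'I_k -> R) : \sum_j (if j == i then w else 0) * v j = w * v i.
  rewrite (bigD1 i) //= eqxx big1 ?addr0 // => j /negbTE ->; exact: mul0r.
have B1 : \forall t \near +oo, h (x t) < q.
  apply: (@barbalat R (h \o x) (fun t => x t i 0) L l) => //= [s t s0 st|p a b p0 a0 ab H].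
    exact: le_trans (ler_norm _) (HL s t s0 st).
  have := carath_mv f x solx (fun j => if j == i then -1 else 0) (- p) a b a0 ab.
  rewrite one mulN1r mulNr lerN2; apply => r ar rb.
  by rewrite one mulN1r lerN2 fh; exact: H.
have B2 : \forall t \near +oo, - h (x t) < q.
  apply: (@barbalat R (fun t => - h (x t)) (fun t => - x t i 0) L (- l)) => //=.
  - move=> s t s0 st; rewrite -opprD lerNl; have := HL s t s0 st.
    by rewrite ler_norml => /andP[].
  - move=> p a b p0 a0 ab H.
    have := carath_mv f x solx (fun j => if j == i then 1 else 0) (- p) a b a0 ab.
    rewrite one mul1r -opprD lerNr -mulNr; apply => r ar rb.
    by rewrite one mul1r lerNr fh; exact: H.
  - exact: cvgN.
near=> t.
have h1 : h (x t) < q by near: t.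
have h2 : - h (x t) < q by near: t.
have h3 : `|h (x t)| < q by rewrite ltr_norml ltrNl h1 h2.
have q1 : q <= 1 by rewrite ge_min lexx.
have qe : q <= e by rewrite ge_min lexx orbT.
rewrite -real_normK ?num_real // expr2; apply: lt_le_trans qe.
have := normr_ge0 (h (x t)); nra.
Unshelve. all: by end_near.
Qed.

(** Asymptotic inequalities pass to a cluster point, because [h] is Lipschitz on a ball containing
    both the trajectory and [l]. *)
Lemma cluster_le0 (l : 'cV[R]_k) (h : 'cV[R]_k -> R) : llip h ->
  (forall (e : R) (A : set R), 0 < e -> (\forall t \near +oo, A t) ->
     exists2 t, A t & `|x t - l| < e) ->
  (forall e : R, 0 < e -> \forall t \near +oo, h (x t) < e) -> h l <= 0.
Proof.
move=> lh cl H; apply/ler_addgt0Pr => e e0; rewrite add0r.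
have [L L0 HL] := lh (`|l| + `|K|).
have A : \forall t \near +oo, h (x t) < e / 2 /\ 0 <= t.
  by apply: filterI; [apply: H; lra|exact: nbhs_pinfty_ge].
have [|t [hA t0] tl] := cl (e / 2 / (L + 1)) _ _ A; first by rewrite !divr_gt0 //; lra.
have h1 : `|h l - h (x t)| <= L * `|x t - l|.
  rewrite (distrC _ l); apply: HL; first by rewrite lerDl.
  by apply: (le_trans (xK _ t0)); have := ler_norm K; have := normr_ge0 l; lra.
have h2 : L * `|x t - l| <= e / 2.
  apply: (@le_trans _ _ ((L + 1) * `|x t - l|)); first by rewrite ler_wpM2r //; lra.
  by rewrite mulrC -ler_pdivlMr ?(ltW tl) //; lra.
have := ler_norm (h l - h (x t)); move: (`|h l - h (x t)|) h1 => w h1 h3; lra.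
Qed.

End LongTime.

Lemma nonincreasing_cvgy (R : realType) (U : R -> R) (b : R) :
  (forall t, b <= U t) -> (forall s t, 0 <= s -> s <= t -> U t <= U s) ->
  exists l : R, U t @[t --> +oo] --> l.
Proof.
move=> Ub Un; pose A := U @` [set t | 0 <= t].
have iA : has_inf A.
  by split; [exists (U 0), 0 => //=|exists b => _ [t _ <-]].
exists (inf A); apply/cvgrPdist_lt => e e0.
have [_ [s /= s0 <-] Us] := inf_adherent e0 iA.
near=> t; have st : s <= t by near: t; apply: nbhs_pinfty_ge; rewrite num_real.
have h1 : inf A <= U t.
  by apply: ge_inf; [case: iA|exists t => //=; exact: le_trans st].
rewrite distrC ger0_norm ?subr_ge0 //.
have := Un s t s0 st; lra.
Unshelve. all: by end_near.
Qed.

(** * Graph Laplacians and state vectors *)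

Section State.
Context {R : realType} {n m : nat}.

Lemma sum_state (F : 'I_(sdim n m) -> R) : \sum_i F i =
  \sum_j F (lshift _ j) +
  (\sum_e F (rshift _ (lshift _ e)) +
  (F (rshift _ (rshift _ (lshift _ 0))) +
  (\sum_j F (rshift _ (rshift _ (rshift _ (lshift _ j)))) +
  (\sum_j F (rshift _ (rshift _ (rshift _ (rshift _ (lshift _ j))))) +
   \sum_e F (rshift _ (rshift _ (rshift _ (rshift _ (rshift _ e))))))))).
Proof. by rewrite /sdim !big_split_ord /= big_ord1. Qed.

Lemma sum3_state (u v w : 'cV[R]_(sdim n m)) : \sum_i u i 0 * (v i 0 * w i 0) =
  \sum_j st_qh u j 0 * (st_qh v j 0 * st_qh w j 0) +
  (\sum_e st_th u e 0 * (st_th v e 0 * st_th w e 0) +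
  (st_la u * (st_la v * st_la w) +
  (\sum_j st_om u j 0 * (st_om v j 0 * st_om w j 0) +
  (\sum_j st_al u j 0 * (st_al v j 0 * st_al w j 0) +
   \sum_e st_et u e 0 * (st_et v e 0 * st_et w e 0))))).
Proof.
rewrite sum_state /st_qh /st_th /st_la /st_om /st_al /st_et.
by do ?[congr (_ + _)]; rewrite ?mxE //; apply: eq_bigr => i _; rewrite !mxE.
Qed.

Lemma st_qhK qh th la om al et : st_qh (@mk_state R n m qh th la om al et) = qh.
Proof. by rewrite /st_qh col_mxKu. Qed.
Lemma st_thK qh th la om al et : st_th (@mk_state R n m qh th la om al et) = th.
Proof. by rewrite /st_th col_mxKd col_mxKu. Qed.
Lemma st_laK qh th la om al et : st_la (@mk_state R n m qh th la om al et) = la.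
Proof. by rewrite /st_la !col_mxKd col_mxKu mxE eqxx. Qed.
Lemma st_omK qh th la om al et : st_om (@mk_state R n m qh th la om al et) = om.
Proof. by rewrite /st_om !col_mxKd col_mxKu. Qed.
Lemma st_alK qh th la om al et : st_al (@mk_state R n m qh th la om al et) = al.
Proof. by rewrite /st_al !col_mxKd col_mxKu. Qed.
Lemma st_etK qh th la om al et : st_et (@mk_state R n m qh th la om al et) = et.
Proof. by rewrite /st_et !col_mxKd. Qed.

Lemma state_ind (P : 'I_(sdim n m) -> Prop) :
  (forall j, P (lshift _ j)) -> (forall e, P (rshift _ (lshift _ e))) ->
  P (rshift _ (rshift _ (lshift _ 0))) ->
  (forall j, P (rshift _ (rshift _ (rshift _ (lshift _ j))))) ->
  (forall j, P (rshift _ (rshift _ (rshift _ (rshift _ (lshift _ j)))))) ->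
  (forall e, P (rshift _ (rshift _ (rshift _ (rshift _ (rshift _ e)))))) ->
  forall i, P i.
Proof.
move=> H1 H2 H3 H4 H5 H6 i.
case: (split_ordP i) => {}i -> //; case: (split_ordP i) => {}i -> //.
case: (split_ordP i) => {}i ->; first by rewrite [i]ord1.
by case: (split_ordP i) => {}i -> //; case: (split_ordP i) => {}i ->.
Qed.

Lemma st0 : ((forall j, @st_qh R n m 0 j 0 = 0) * (@st_th R n m 0 = 0) *
  (@st_la R n m 0 = 0) * (forall j, @st_om R n m 0 j 0 = 0) *
  (forall j, @st_al R n m 0 j 0 = 0) * (forall e, @st_et R n m 0 e 0 = 0))%type.
Proof.
rewrite /st_la; do ![split]; try by move=> ?; rewrite !mxE.
  by apply/matrixP => i j; rewrite !mxE.
by rewrite !mxE.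
Qed.

End State.

Lemma sum_trmx_mul (R : realType) p q (A : 'M[R]_(p, q)) (u : 'cV[R]_q) (v : 'cV[R]_p) :
  \sum_e u e 0 * (A^T *m v) e 0 = \sum_j (A *m u) j 0 * v j 0.
Proof.
under eq_bigr do rewrite mxE mulr_sumr.
rewrite exchange_big /=; apply: eq_bigr => j _; rewrite mxE mulr_suml.
by apply: eq_bigr => e _; rewrite mxE mulrCA mulrA.
Qed.

Lemma cvBE (R : realType) k (u v : 'cV[R]_k) i : (u - v) i 0 = u i 0 - v i 0.
Proof. by rewrite !mxE. Qed.

Section PositiveDiag.
Context {R : realType} {k : nat} (A : 'M[R]_k).
Hypothesis pA : positive_diag A.

Lemma positive_diag_mul (v : 'cV[R]_k) i : (A *m v) i 0 = A i i * v i 0.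
Proof.
rewrite mxE (bigD1 i) //= big1 ?addr0 // => j ji.
by case: pA => /(_ i j) -> //; rewrite ?mul0r // eq_sym.
Qed.

Lemma positive_diag_inv (v : 'cV[R]_k) i : (invmx A *m v) i 0 = v i 0 / A i i.
Proof.
have Aii j : A j j != 0 by case: pA => _ /(_ j) h; rewrite gt_eqF.
have uA : A \in unitmx.
  have -> : A = diag_mx (\row_j A j j).
    apply/matrixP => a b; rewrite !mxE; case: eqP => [->|/eqP ab] /=.
      by rewrite mulr1n.
    by rewrite mulr0n; case: pA => -> .
  by rewrite unitmxE det_diag unitfE; apply/prodf_neq0 => j _; rewrite mxE.
have := positive_diag_mul (invmx A *m v) i; rewrite mulmxA mulmxV // mul1mx => ->.
by rewrite mulrAC divff ?mul1r.
Qed.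

End PositiveDiag.

(** * Incidence matrix and Laplacian of a connected graph *)

Section Graph.
Context {R : realType} {n m : nat} (src dst : 'I_m -> 'I_n).
Hypotheses (noloop : no_self_loops src dst) (conn : graph_connected src dst).
Local Notation C := (incidence R src dst).

Lemma incidence_col_sum e : \sum_j C j e = 0.
Proof.
rewrite (bigD1 (src e)) //= (bigD1 (dst e)) 1?eq_sym ?noloop //=.
rewrite !mxE !eqxx (negbTE (noloop e)) big1 ?addr0 ?subrr // => j /andP[js jd].
by rewrite mxE eq_sym (negbTE js) eq_sym (negbTE jd).
Qed.

Lemma incidence_tr_mul (v : 'cV[R]_n) e : (C^T *m v) e 0 = v (src e) 0 - v (dst e) 0.
Proof.
rewrite mxE (bigD1 (src e)) //= (bigD1 (dst e)) 1?eq_sym ?noloop //=.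
rewrite !mxE !eqxx (negbTE (noloop e)) big1 ?addr0 => [|j /andP[js jd]].
  by rewrite mul1r mulN1r.
by rewrite !mxE eq_sym (negbTE js) eq_sym (negbTE jd) mul0r.
Qed.

(** The vector takes equal values at the two ends of each edge, hence along any path. *)
Lemma incidence_ker (v : 'cV[R]_n) : C^T *m v = 0 -> exists a, forall j, v j 0 = a.
Proof.
move=> Cv.
have edge e : v (src e) 0 = v (dst e) 0.
  by apply/eqP; rewrite -subr_eq0 -incidence_tr_mul Cv mxE.
have adj j l : graph_adj src dst j l -> v j 0 = v l 0.
  by move=> /existsP[e /orP[] /andP[/eqP <- /eqP <-]]; rewrite edge.
have path_const p : forall j, path (graph_adj src dst) j p -> v j 0 = v (last j p) 0.
  by elim: p => //= l p IH j /andP[/adj -> /IH].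
case: (pickP (fun _ : 'I_n => true)) => [j0 _|none]; last by exists 0 => j; have := none j.
exists (v j0 0) => j; have /connectP[p jp ->] := conn j j0.
exact: path_const.
Qed.

Variables (B : 'M[R]_m) (Ldag : 'M[R]_n).
Hypothesis pB : positive_diag B.
Let L := C *m B *m C^T.
Hypothesis MP : is_MP_inverse L Ldag.

Lemma laplacian_sym : L^T = L.
Proof.
have BT : B^T = B.
  apply/matrixP => i j; rewrite mxE; have [->//|ij] := eqVneq i j.
  by rewrite !pB.1 // eq_sym.
by rewrite /L !trmx_mul trmxK BT mulmxA.
Qed.

(** The energy of [v] is a sum of squares of edge differences weighted by positive entries of [B],
    so each difference vanishes. *)
Lemma laplacian_ker (v : 'cV[R]_n) : L *m v = 0 -> exists a, forall j, v j 0 = a.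
Proof.
move=> Lv; apply: incidence_ker.
have E : \sum_e B e e * (C^T *m v) e 0 ^+ 2 = 0.
  transitivity (\sum_e (B *m (C^T *m v)) e 0 * (C^T *m v) e 0).
    by apply: eq_bigr => e _; rewrite positive_diag_mul // -mulrA.
  rewrite sum_trmx_mul big1 // => j _.
  have -> : C *m (B *m (C^T *m v)) = 0 by rewrite -Lv /L !mulmxA.
  by rewrite mxE mul0r.
have Bge e : 0 <= B e e * (C^T *m v) e 0 ^+ 2.
  by rewrite mulr_ge0 ?sqr_ge0 // ltW // pB.2.
apply/matrixP => e i; rewrite [i]ord1 [RHS]mxE.
have /eqP := E; rewrite psumr_eq0 // => /allP /(_ e); rewrite mem_index_enum => /(_ isT).
by rewrite mulf_eq0 (gt_eqF (pB.2 e)) sqrf_eq0 => /eqP.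
Qed.

(* [L *m Ldag] is the orthogonal projector onto the zero-sum vectors. *)
Lemma flow_residual (v : 'cV[R]_n) : exists th : 'cV[R]_m,
  forall j, `|v j 0 - (C *m B *m th) j 0| <= `|\sum_i v i 0|.
Proof.
have [MP1 MP2 MP3 MP4] := MP.
exists (C^T *m (Ldag *m v)) => j.
pose u := v - L *m Ldag *m v.
have uE i : v i 0 - (C *m B *m (C^T *m (Ldag *m v))) i 0 = u i 0.
  by rewrite cvBE /L !mulmxA.
(* Transposing [L *m Ldag *m L = L] and using both symmetries gives [L *m (L *m Ldag) = L], so [u]
   is in the kernel of the Laplacian. *)
have [a ua] : exists a, forall i, u i 0 = a.
  apply: laplacian_ker; rewrite /u mulmxBr mulmxA.
  have -> : L *m (L *m Ldag) = L.
    by rewrite -[L *m (L *m Ldag)]trmxK trmx_mul MP3 laplacian_sym MP1 laplacian_sym.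
  by rewrite subrr.
have su : \sum_i u i 0 = \sum_i v i 0.
  under eq_bigr do rewrite cvBE.
  rewrite sumrB; have -> : \sum_i (L *m Ldag *m v) i 0 = 0; last by rewrite subr0.
  under eq_bigr do rewrite /L -!mulmxA mxE.
  by rewrite exchange_big /= big1 // => e _; rewrite -mulr_suml incidence_col_sum mul0r.
(* Every entry of [u] is the mean of [v], hence at most the total in absolute value. *)
rewrite uE -su ua; under eq_bigr do rewrite ua.
rewrite sumr_const card_ord -mulr_natl normrM ler_peMl //.
have n0 : (0 < n)%N by apply: leq_ltn_trans (ltn_ord j).
by rewrite ger0_norm ?ler0n // ler1n.
Qed.

End Graph.

(** * Penalised dispatch *)

Section Penalty.
Context {R : realType} {n r : nat}.
Variables (c cbar d : 'cV[R]_n) (H : 'M[R]_(n, r)) (F : 'cV[R]_r).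
Hypothesis pc : forall j, 0 < c j 0.

Definition cost (q : 'cV[R]_n) : R := \sum_j (c j 0 / 2 * q j 0 ^+ 2 + cbar j 0 * q j 0).

Definition balance (q : 'cV[R]_n) : R := \sum_j (q j 0 - d j 0).

Definition excess (q : 'cV[R]_n) e : R := (H^T *m (q - d) - F) e 0.

(** Exterior quadratic penalty. The multipliers of the dispatch problem will be [k] times the
    positive parts of the violations and [-k] times the balance. *)
Definition penalty (k : R) (q : 'cV[R]_n) : R :=
  cost q + k / 2 * (\sum_e Num.max (excess q e) 0 ^+ 2 + balance q ^+ 2).

(** Half of the quadratic term absorbs the linear one: the difference is a complete square. *)
Lemma cost_coercive (q : 'cV[R]_n) :
  \sum_j c j 0 / 4 * q j 0 ^+ 2 - \sum_j cbar j 0 ^+ 2 / c j 0 <= cost q.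
Proof.
rewrite -sumrB; apply: ler_sum => j _.
rewrite -subr_ge0.
have -> : c j 0 / 2 * q j 0 ^+ 2 + cbar j 0 * q j 0 -
    (c j 0 / 4 * q j 0 ^+ 2 - cbar j 0 ^+ 2 / c j 0) =
    (c j 0 / 2 * q j 0 + cbar j 0) ^+ 2 / c j 0.
  by field; rewrite gt_eqF.
by rewrite divr_ge0 ?sqr_ge0 // ltW.
Qed.

Lemma affine_excess e : affine (excess^~ e).
Proof.
apply: (affine_ext (fun q : 'cV[R]_n => (H^T *m (q - d)) e 0 - F e 0)).
  by move=> q; rewrite /excess cvBE.
apply: affineB (affine_cst _); apply: affine_mulmx => j.
apply: (affine_ext (fun q : 'cV[R]_n => q j 0 - d j 0)); first by move=> q; rewrite cvBE.
exact: affineB (affine_coord j) (affine_cst _).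
Qed.

Lemma llip_penalty k : llip (penalty k).
Proof.
apply: llipD.
  apply: llip_sum => j; apply: llipD; first exact/llipZ/llip_sqr/affine_llip/affine_coord.
  exact/llipZ/affine_llip/affine_coord.
apply/llipZ/llipD.
  by apply: llip_sum => e; exact/llip_sqr/llip_max0/affine_llip/affine_excess.
apply/llip_sqr/affine_llip/affine_sum => j.
exact: affineB (affine_coord j) (affine_cst _).
Qed.

Lemma penalty_min k : 0 <= k -> exists q, forall p, penalty k q <= penalty k p.
Proof.
move=> k0.
pose A := `|penalty k 0 + \sum_j cbar j 0 ^+ 2 / c j 0|.
(* On the sublevel set of 0 each [q j 0 ^+ 2] is at most [A / (c j 0 / 4)], and an absolute value is
   at most 1 plus its square. *)
apply: (coercive_min _ 0 (1 + \sum_j A / (c j 0 / 4))); first exact: llip_penalty.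
move=> q qle.
have A0 : 0 <= A by exact: normr_ge0.
have Ac j : 0 <= A / (c j 0 / 4) by apply: divr_ge0 => //; apply: divr_ge0 => //; exact: ltW.
apply: cvnorm_leP => [|j]; first by rewrite addr_ge0 // sumr_ge0.
have pen : cost q <= penalty k q.
  rewrite lerDl mulr_ge0 ?divr_ge0 // addr_ge0 ?sqr_ge0 // sumr_ge0 // => e _.
  exact: sqr_ge0.
have cA : \sum_i c i 0 / 4 * q i 0 ^+ 2 <= A.
  have := cost_coercive q; have := ler_norm (penalty k 0 + \sum_j cbar j 0 ^+ 2 / c j 0).
  by rewrite -/A; lra.
have cj : c j 0 / 4 * q j 0 ^+ 2 <= A.
  apply: le_trans cA; rewrite (bigD1 j) //= ler_wpDr // sumr_ge0 // => i _.
  by apply: mulr_ge0; [apply: divr_ge0 => //; exact: ltW|exact: sqr_ge0].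
have qj : q j 0 ^+ 2 <= A / (c j 0 / 4).
  by rewrite ler_pdivlMr ?divr_gt0 // mulrC.
have : A / (c j 0 / 4) <= \sum_j A / (c j 0 / 4).
  by rewrite (bigD1 j) //= ler_wpDr // sumr_ge0.
rewrite -real_normK ?num_real // in qj.
move: (A / (c j 0 / 4)) (\sum_j _) qj => a s qj sa.
have := normr_ge0 (q j 0); nra.
Qed.

(** Differentiation is avoided: moving coordinate [j] by [t] changes the penalty by at most
    [t * G + t ^+ 2 * Q], and minimality for all [t] forces [G = 0]. *)
Lemma penalty_stationary k q : 0 <= k -> (forall p, penalty k q <= penalty k p) ->
  forall j, c j 0 * q j 0 + cbar j 0
    + k * (\sum_e H j e * Num.max (excess q e) 0 + balance q) = 0.
Proof.
move=> k0 qmin j.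
set G := _ + _.
pose Q := c j 0 / 2 + k / 2 * (\sum_e H j e ^+ 2 + 1).
have Q0 : 0 < Q.
  rewrite ltr_pwDl ?divr_gt0 // mulr_ge0 ?divr_ge0 // addr_ge0 // sumr_ge0 // => e _.
  exact: sqr_ge0.
suff HQ t : 0 <= t * G + t ^+ 2 * Q.
  (* This [t] minimises the quadratic, with value [- G ^+ 2 / (4 * Q)]. *)
  have := HQ (- G / (2 * Q)).
  have -> : - G / (2 * Q) * G + (- G / (2 * Q)) ^+ 2 * Q = - (G ^+ 2 / (4 * Q)).
    by field; rewrite gt_eqF.
  rewrite oppr_ge0 pmulr_lle0; last by rewrite invr_gt0; lra.
  by move=> h; apply/eqP; rewrite -sqrf_eq0 eq_le h sqr_ge0.
have := qmin (q + t *: delta_mx j 0).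
have pE i : (q + t *: delta_mx j 0) i 0 = q i 0 + t * (i == j)%:R.
  by rewrite !mxE eqxx andbT.
have costE : cost (q + t *: delta_mx j 0) = cost q + t * (c j 0 * q j 0 + cbar j 0)
    + t ^+ 2 * (c j 0 / 2).
  rewrite /cost (bigD1 j) //= [in RHS](bigD1 j) //= pE eqxx mulr1.
  under eq_bigr => i ij do rewrite pE (negbTE ij) mulr0 addr0.
  by move: (\sum_(_ < _ | _) _) => s; field.
have balE : balance (q + t *: delta_mx j 0) = balance q + t.
  rewrite /balance (bigD1 j) //= [in RHS](bigD1 j) //= pE eqxx mulr1.
  under eq_bigr => i ij do rewrite pE (negbTE ij) mulr0 addr0.
  by move: (\sum_(_ < _ | _) _) => s; ring.
have excE e : excess (q + t *: delta_mx j 0) e = excess q e + t * H j e.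
  rewrite /excess !cvBE [q + _ - d]addrAC mulmxDr -scalemxAr mxE [RHS]addrAC; congr (_ + _ - _).
    rewrite mxE mxE (bigD1 j) //= big1 ?addr0 => [|i ij].
      by rewrite !mxE !eqxx mulr1.
    by rewrite !mxE (negbTE ij) mulr0.
rewrite /penalty costE balE.
(* The squared positive part lies below its tangent at [excess q e] plus the square of the
   increment. *)
have : \sum_e Num.max (excess (q + t *: delta_mx j 0) e) 0 ^+ 2 <=
    \sum_e Num.max (excess q e) 0 ^+ 2
    + 2 * t * (\sum_e H j e * Num.max (excess q e) 0) + t ^+ 2 * \sum_e H j e ^+ 2.
  rewrite !mulr_sumr -!big_split /=; apply: ler_sum => e _; rewrite excE.
  move: (excess q e) (H j e) => a b; rewrite !maxElt; do 2 case: ltP => ?; nra.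
move=> h1 h2; have := ler_wpM2l k0 h1.
move: h2; rewrite /G /Q; move: (\sum_e _) (\sum_e _) (\sum_e _) (\sum_e _) => s1 s2 s3 s4.
nra.
Qed.

End Penalty.

(** * The closed-loop system *)

Section System.
Variables (R : realType) (n m : nat) (C : 'M[R]_(n, m)).
Variables (B : 'M[R]_m) (D M Tq : 'M[R]_n) (Tl : R) (Te : 'M[R]_(m + m)).
Variables (tau c cbar d : 'cV[R]_n) (H : 'M[R]_(n, m + m)) (F : 'cV[R]_(m + m)).
Variable rho : R.
Hypotheses (pB : positive_diag B) (pD : positive_diag D) (pM : positive_diag M).
Hypotheses (pTq : positive_diag Tq) (pTl : 0 < Tl) (pTe : positive_diag Te).
Hypotheses (ptau : forall j, 0 < tau j 0) (pc : forall j, 0 < c j 0).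
Hypotheses (prho : 0 < rho) (rhoc : forall j, rho < 4 * c j 0).
Hypothesis sumC : forall e, \sum_j C j e = 0.
Hypothesis kerC : forall om : 'cV[R]_n, C^T *m om = 0 -> exists a, forall j, om j 0 = a.

Local Notation state := 'cV[R]_(sdim n m).
Local Notation f := (field C B D M Tq Tl Te tau c cbar d H F rho).
Implicit Types (x y : state).

(** * Prices, supplies and equilibria *)

Definition prices x : 'cV[R]_n := st_la x *: const_mx 1 - H *m st_et x - st_om x.
Definition supply x : 'cV[R]_n := rho^-1 *: (prices x - st_al x) + st_qh x.
Definition slack x : 'cV[R]_(m + m) := H^T *m (supply x - d) - F.

Lemma pricesE x j : prices x j 0 = st_la x - (H *m st_et x) j 0 - st_om x j 0.
Proof. by rewrite /prices !cvBE 2!mxE mulr1. Qed.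

Lemma supplyE x j : supply x j 0 = (prices x j 0 - st_al x j 0) / rho + st_qh x j 0.
Proof. by rewrite /supply mxE [X in X + _ = _]mxE mulrC cvBE. Qed.

Lemma field_qh x j : st_qh (f x) j 0 = (prices x j 0 - st_al x j 0) / Tq j j.
Proof. by rewrite /field st_qhK positive_diag_inv // cvBE. Qed.

Lemma field_th x : st_th (f x) = C^T *m st_om x.
Proof. by rewrite /field st_thK. Qed.

Lemma field_la x : st_la (f x) = - (\sum_j (supply x j 0 - d j 0)) / Tl.
Proof. by rewrite /field st_laK; under eq_bigr do rewrite cvBE. Qed.

Lemma field_om x j : st_om (f x) j 0 =
  (supply x j 0 - d j 0 - D j j * st_om x j 0 - (C *m B *m st_th x) j 0) / M j j.
Proof.
rewrite /field st_omK positive_diag_inv //; congr (_ / _).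
by rewrite !cvBE positive_diag_mul.
Qed.

Lemma field_al x j : st_al (f x) j 0 =
  (supply x j 0 - (prices x j 0 - cbar j 0) / c j 0) / tau j 0.
Proof. by rewrite /field st_alK mxE. Qed.

Lemma field_et x e : st_et (f x) e 0 =
  (if (0 < slack x e 0) || (0 < st_et x e 0) then slack x e 0 else 0) / Te e e.
Proof. by rewrite /field st_etK positive_diag_inv // /proj_plus mxE. Qed.

Lemma sum_mulC (v : 'cV[R]_m) : \sum_j (C *m v) j 0 = 0.
Proof.
under eq_bigr do rewrite mxE.
by rewrite exchange_big /= big1 // => e _; rewrite -mulr_suml sumC mul0r.
Qed.

(** The equation for lambda has no field of its own: it follows from [kkt_flow], because the columns
    of [C] sum to zero. Only the sign condition [kkt_et] separates these points from the zeros of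
    the field. *)
Record kkt x : Prop := Kkt {
  kkt_om : forall j, st_om x j 0 = 0;
  kkt_al : forall j, prices x j 0 = st_al x j 0;
  kkt_q : forall j, supply x j 0 = (prices x j 0 - cbar j 0) / c j 0;
  kkt_flow : forall j, supply x j 0 - d j 0 = (C *m B *m st_th x) j 0;
  kkt_slack : forall e, slack x e 0 <= 0;
  kkt_et : forall e, 0 <= st_et x e 0;
  kkt_compl : forall e, st_et x e 0 * slack x e 0 = 0 }.

(** The angle equation puts omega in the kernel of [C^T], so it is a constant [a]. Summing the
    frequency equations, where supply balances and flows cancel, leaves [a] times the total damping
    equal to zero. *)
Lemma field0_om x : f x = 0 -> forall j, st_om x j 0 = 0.
Proof.
move=> fx0.
have om' j : supply x j 0 - d j 0 - D j j * st_om x j 0 - (C *m B *m st_th x) j 0 = 0.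
  have := field_om x j; rewrite fx0 st0 => /esym/eqP.
  by rewrite mulf_eq0 invr_eq0 (gt_eqF (pM.2 j)) orbF => /eqP.
have la' : \sum_j (supply x j 0 - d j 0) = 0.
  have := field_la x; rewrite fx0 st0 => /esym/eqP.
  by rewrite mulf_eq0 invr_eq0 (gt_eqF pTl) orbF oppr_eq0 => /eqP.
have [a oma] : exists a, forall j, st_om x j 0 = a.
  by apply: kerC; rewrite -field_th fx0 st0.
have : \sum_j D j j * a = 0.
  transitivity (\sum_j (supply x j 0 - d j 0) - \sum_j (C *m (B *m st_th x)) j 0).
    rewrite -sumrB; apply: eq_bigr => j _; rewrite mulmxA.
    by have := om' j; rewrite oma; lra.
  by rewrite la' sum_mulC subrr.
rewrite -mulr_suml => /eqP; rewrite mulf_eq0 => /orP[Da|/eqP a0] j; last by rewrite oma.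
exfalso; move: Da; apply/negP; rewrite gt_eqF // (bigD1 j) //=.
rewrite ltr_pwDl //; first by case: pD => _; apply.
by apply: sumr_ge0 => i _; apply: ltW; case: pD => _; apply.
Qed.

(** The projected component vanishes exactly when the slack is zero, or when slack and eta are both
    nonpositive. This is how negative eta can occur at a zero of the field. *)
Lemma field0P x : f x = 0 <-> [/\ forall j, st_om x j 0 = 0,
  forall j, prices x j 0 = st_al x j 0,
  forall j, supply x j 0 = (prices x j 0 - cbar j 0) / c j 0,
  forall j, supply x j 0 - d j 0 = (C *m B *m st_th x) j 0 &
  forall e, slack x e 0 = 0 \/ (slack x e 0 <= 0 /\ st_et x e 0 <= 0)].
Proof.
split=> [fx0|[om0 al0 q0 fl0 et0]].
  have om0 := field0_om x fx0; split=> //.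
  - move=> j; have := field_qh x j; rewrite fx0 st0 => /esym/eqP.
    by rewrite mulf_eq0 invr_eq0 (gt_eqF (pTq.2 j)) orbF subr_eq0 => /eqP.
  - move=> j; have := field_al x j; rewrite fx0 st0 => /esym/eqP.
    by rewrite mulf_eq0 invr_eq0 (gt_eqF (ptau j)) orbF subr_eq0 => /eqP.
  - move=> j; have := field_om x j; rewrite fx0 st0 => /esym/eqP.
    rewrite mulf_eq0 invr_eq0 (gt_eqF (pM.2 j)) orbF.
    by rewrite om0 mulr0 subr0 subr_eq0 => /eqP.
  - move=> e; have := field_et x e; rewrite fx0 st0 => /esym/eqP.
    rewrite mulf_eq0 invr_eq0 (gt_eqF (pTe.2 e)) orbF.
    case: ifPn => [_ /eqP ->|]; first by left.
    by rewrite negb_or -!leNgt => /andP[h1 h2] _; right.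
have S0 : \sum_j (supply x j 0 - d j 0) = 0.
  by rewrite -[RHS](sum_mulC (B *m st_th x)); apply: eq_bigr => j _; rewrite fl0 mulmxA.
have z (v : state) : (forall j, st_qh v j 0 = 0) -> (forall j, st_th v j 0 = 0) ->
    st_la v = 0 -> (forall j, st_om v j 0 = 0) -> (forall j, st_al v j 0 = 0) ->
    (forall j, st_et v j 0 = 0) -> v = 0.
  rewrite /st_qh /st_th /st_la /st_om /st_al /st_et => z1 z2 z3 z4 z5 z6.
  apply/matrixP => i j; rewrite [j]ord1 [RHS]mxE; move: i; apply: state_ind.
  - by move=> i; rewrite -[RHS](z1 i) !mxE.
  - by move=> i; rewrite -[RHS](z2 i) !mxE.
  - by rewrite -[RHS]z3 !mxE.
  - by move=> i; rewrite -[RHS](z4 i) !mxE.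
  - by move=> i; rewrite -[RHS](z5 i) !mxE.
  - by move=> i; rewrite -[RHS](z6 i) !mxE.
apply: z.
- by move=> j; rewrite field_qh al0 subrr mul0r.
- move=> e; rewrite field_th mxE big1 // => j _; rewrite om0 mulr0 //.
- by rewrite field_la S0 oppr0 mul0r.
- by move=> j; rewrite field_om om0 mulr0 subr0 fl0 subrr mul0r.
- by move=> j; rewrite field_al q0 subrr mul0r.
- move=> e; rewrite field_et; case: (et0 e) => [->|[s0 e0]]; first by case: ifP; rewrite mul0r.
  by rewrite !ltNge s0 e0 /= mul0r.
Qed.

Lemma kkt_field0 x : kkt x -> f x = 0.
Proof.
move=> [k1 k2 k3 k4 k5 k6 k7]; apply/field0P; split=> // e.
have /eqP := k7 e; rewrite mulf_eq0 => /orP[/eqP ->|/eqP ->]; last by left.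
by right; split.
Qed.

(** * Weighted distance to a KKT point and its dissipation *)

Definition weights : state :=
  mk_state (\col_j Tq j j) (\col_e B e e) Tl (\col_j M j j) tau (\col_e Te e e).

Lemma weights_gt0 i : 0 < weights i 0.
Proof.
move: i; apply: state_ind; rewrite /weights /mk_state.
- by move=> j; rewrite col_mxEu mxE; case: pTq.
- by move=> j; rewrite col_mxEd col_mxEu mxE; case: pB.
- by rewrite 2!col_mxEd col_mxEu mxE eqxx.
- by move=> j; rewrite 3!col_mxEd col_mxEu mxE; case: pM.
- by move=> j; rewrite 4!col_mxEd col_mxEu.
- by move=> j; rewrite 5!col_mxEd mxE; case: pTe.
Qed.

Definition dissipation (xs x : state) : R :=
  \sum_j (D j j * st_om x j 0 ^+ 2
    + ((prices x j 0 - prices xs j 0) - (st_al x j 0 - st_al xs j 0)) ^+ 2 / rho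
    + (st_al x j 0 - st_al xs j 0) * (prices x j 0 - prices xs j 0) / c j 0)
  - \sum_e st_et x e 0 * slack xs e 0.

(** The time constants cancel the scalings of the rates, and the weight [B] on the angles makes the
    flow terms cancel. The one inequality comes from the projection. *)
Lemma lyapunov_rate xs x : kkt xs -> (forall e, 0 <= st_et x e 0) ->
  \sum_i weights i 0 * ((x i 0 - xs i 0) * f x i 0) <= - dissipation xs x.
Proof.
move=> kx etx.
have -> : \sum_i weights i 0 * ((x i 0 - xs i 0) * f x i 0) =
    \sum_i weights i 0 * ((x - xs) i 0 * f x i 0) by apply: eq_bigr => i _; rewrite !mxE.
have E1 u v j : st_qh (u - v) j 0 = st_qh u j 0 - st_qh v j 0 :> R by rewrite !mxE.
have E2 u v j : st_th (u - v) j 0 = st_th u j 0 - st_th v j 0 :> R by rewrite !mxE.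
have E3 u v : st_la (u - v) = st_la u - st_la v :> R by rewrite /st_la !mxE.
have E4 u v j : st_om (u - v) j 0 = st_om u j 0 - st_om v j 0 :> R by rewrite !mxE.
have E5 u v j : st_al (u - v) j 0 = st_al u j 0 - st_al v j 0 :> R by rewrite !mxE.
have E6 u v j : st_et (u - v) j 0 = st_et u j 0 - st_et v j 0 :> R by rewrite !mxE.
rewrite sum3_state E3 field_th field_la /weights st_laK.
set T1 := \sum_j _; set T2 := \sum_e _; set T3 := Tl * _; set T4 := \sum_j _.
set T5 := \sum_j _; set T6 := \sum_e _.
have T1E : T1 = \sum_j (st_qh x j 0 - st_qh xs j 0) * (prices x j 0 - st_al x j 0).
  apply: eq_bigr => j _; rewrite st_qhK E1 field_qh mxE; field.
  by rewrite gt_eqF //; case: pTq.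
have T2E : T2 = \sum_j ((C *m B *m st_th x) j 0 - (C *m B *m st_th xs) j 0) * st_om x j 0.
  transitivity (\sum_e (B *m (st_th x - st_th xs)) e 0 * (C^T *m st_om x) e 0).
    apply: eq_bigr => e _; rewrite st_thK E2 positive_diag_mul // mxE -mulrA.
    by congr (_ * (_ * _)); rewrite cvBE.
  rewrite sum_trmx_mul; apply: eq_bigr => j _; congr (_ * _).
  by rewrite mulmxA mulmxBr cvBE.
(* The total imbalance at [xs] vanishes, by [kkt_flow] and the column sums of [C], so it can be
   subtracted. *)
have T3E : T3 = \sum_j - (st_la x - st_la xs) * (supply x j 0 - supply xs j 0).
  have -> : T3 = - (st_la x - st_la xs) * \sum_j (supply x j 0 - d j 0).
    by rewrite /T3; field; rewrite gt_eqF.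
  rewrite -mulr_sumr; congr (_ * _).
  transitivity (\sum_j (supply x j 0 - d j 0) - \sum_j (C *m (B *m st_th xs)) j 0).
    by rewrite sum_mulC subr0.
  rewrite -sumrB; apply: eq_bigr => j _.
  by rewrite mulmxA -(kkt_flow _ kx); ring.
have T4E : T4 = \sum_j st_om x j 0 * (supply x j 0 - d j 0 - D j j * st_om x j 0
    - (C *m B *m st_th x) j 0).
  apply: eq_bigr => j _; rewrite st_omK E4 (kkt_om _ kx) subr0 field_om mxE; field.
  by rewrite gt_eqF //; case: pM.
have T5E : T5 = \sum_j (st_al x j 0 - st_al xs j 0) *
    (supply x j 0 - (prices x j 0 - cbar j 0) / c j 0).
  apply: eq_bigr => j _; rewrite st_alK E5 field_al; field.
  by rewrite !gt_eqF.
(* Where the projection acts, eta is 0 and the slack is nonpositive, so the removed term is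
   nonnegative. Elsewhere complementarity at [xs] gives equality. *)
have T6E : T6 <= \sum_j (H *m (st_et x - st_et xs)) j 0 * (supply x j 0 - supply xs j 0)
    + \sum_e st_et x e 0 * slack xs e 0.
  have -> : \sum_j (H *m (st_et x - st_et xs)) j 0 * (supply x j 0 - supply xs j 0) =
      \sum_e (st_et x e 0 - st_et xs e 0) * (slack x e 0 - slack xs e 0).
    transitivity (\sum_j (H *m (st_et x - st_et xs)) j 0 * (supply x - supply xs) j 0).
      by apply: eq_bigr => j _; rewrite cvBE.
    rewrite -sum_trmx_mul; apply: eq_bigr => e _; congr (_ * _).
      by rewrite cvBE.
    have -> : supply x - supply xs = (supply x - d) - (supply xs - d).
      by rewrite opprB addrA subrK.
    by rewrite mulmxBr /slack !cvBE; ring.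
  rewrite -big_split /=; apply: ler_sum => e _.
  rewrite st_etK E6 field_et mxE.
  have Te0 : Te e e != 0 by rewrite gt_eqF //; case: pTe.
  have -> v : Te e e * ((st_et x e 0 - st_et xs e 0) * (v / Te e e)) =
      (st_et x e 0 - st_et xs e 0) * v by field.
  have k7 := kkt_compl _ kx e.
  have -> : (st_et x e 0 - st_et xs e 0) * (slack x e 0 - slack xs e 0)
      + st_et x e 0 * slack xs e 0 = (st_et x e 0 - st_et xs e 0) * slack x e 0.
    by rewrite -[RHS]addr0 -k7; ring.
  case: ifPn => // ; rewrite negb_or -!leNgt => /andP[s0 e0].
  have -> : st_et x e 0 = 0 by apply: le_anti; rewrite e0 etx.
  by rewrite mulr0 sub0r mulNr oppr_ge0 mulr_ge0_le0 // (kkt_et _ kx).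
rewrite T1E T2E T3E T4E T5E /dissipation.
set S1 := \sum_j _; set S2 := \sum_j _; set S3 := \sum_j _; set S4 := \sum_j _.
set S5 := \sum_j _; set S7 := \sum_j _; set S8 := \sum_e _.
set S6 := \sum_j _ in T6E.
suff : S1 + S2 + S3 + S4 + S5 + S6 = - S7 by move: T6E; rewrite -/S8; lra.
(* What remains is an identity at each node, once [H *m eta], [qhat] and [cbar] are expressed
   through prices and supplies. *)
rewrite /S1 /S2 /S3 /S4 /S5 /S6 /S7 -!big_split -sumrN; apply: eq_bigr => j _ /=.
have Hd : (H *m (st_et x - st_et xs)) j 0 = (H *m st_et x) j 0 - (H *m st_et xs) j 0.
  by rewrite mulmxBr cvBE.
have k1 := kkt_om _ kx j; have k2 := kkt_al _ kx j; have k3 := kkt_q _ kx j.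
have k4 := kkt_flow _ kx j.
have Px : (H *m st_et x) j 0 = st_la x - st_om x j 0 - prices x j 0 by rewrite pricesE; ring.
have Pxs : (H *m st_et xs) j 0 = st_la xs - prices xs j 0 by rewrite pricesE k1; ring.
rewrite Hd Px Pxs -k4 -k2.
have qh : st_qh x j 0 = supply x j 0 - (prices x j 0 - st_al x j 0) / rho by rewrite supplyE; ring.
have qhs : st_qh xs j 0 = supply xs j 0 by rewrite supplyE k2; ring.
rewrite qh qhs.
have -> : cbar j 0 = prices xs j 0 - c j 0 * supply xs j 0.
  by rewrite k3; field; rewrite gt_eqF.
by field; rewrite !gt_eqF.
Qed.

(** * Affine functions of the state and bounds on the field *)

Lemma affine_qh j : affine (fun x : state => st_qh x j 0).
Proof. by apply: affine_ext (affine_coord (lshift _ j)) => x; rewrite !mxE. Qed.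

Lemma affine_th e : affine (fun x : state => st_th x e 0).
Proof. by apply: affine_ext (affine_coord (rshift _ (lshift _ e))) => x; rewrite !mxE. Qed.

Lemma affine_la : affine (fun x : state => st_la x).
Proof.
apply: affine_ext (affine_coord (rshift _ (rshift _ (lshift _ 0)))) => x.
by rewrite /st_la !mxE.
Qed.

Lemma affine_om j : affine (fun x : state => st_om x j 0).
Proof.
apply: affine_ext (affine_coord (rshift _ (rshift _ (rshift _ (lshift _ j))))) => x.
by rewrite !mxE.
Qed.

Lemma affine_al j : affine (fun x : state => st_al x j 0).
Proof.
apply: affine_ext
  (affine_coord (rshift _ (rshift _ (rshift _ (rshift _ (lshift _ j)))))) => x.
by rewrite !mxE.
Qed.

Lemma affine_et e : affine (fun x : state => st_et x e 0).
Proof.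
apply: affine_ext
  (affine_coord (rshift _ (rshift _ (rshift _ (rshift _ (rshift _ e)))))) => x.
by rewrite !mxE.
Qed.

Lemma affine_prices j : affine (fun x => prices x j 0).
Proof.
apply: (affine_ext (fun x => st_la x - (H *m st_et x) j 0 - st_om x j 0)).
  by move=> x; rewrite pricesE.
apply: affineB (affine_om j); apply: affineB affine_la _.
exact: affine_mulmx affine_et.
Qed.

Lemma affine_supply j : affine (fun x => supply x j 0).
Proof.
apply: (affine_ext (fun x => (prices x j 0 - st_al x j 0) / rho + st_qh x j 0)).
  by move=> x; rewrite supplyE.
by apply: affineD (affine_qh j); apply/affine_divr/affineB; [exact: affine_prices|exact: affine_al].
Qed.

Lemma affine_slack e : affine (fun x => slack x e 0).
Proof.
apply: (affine_ext (fun x => (H^T *m (supply x - d)) e 0 - F e 0)).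
  by move=> x; rewrite /slack cvBE.
apply: affineB (affine_cst _); apply: affine_mulmx => j.
apply: (affine_ext (fun x => supply x j 0 - d j 0)); first by move=> x; rewrite cvBE.
exact: affineB (affine_supply j) (affine_cst _).
Qed.

Lemma affine_flow j : affine (fun x : state => (C *m B *m st_th x) j 0).
Proof. exact: affine_mulmx affine_th. Qed.

Definition al_rate j x := (supply x j 0 - (prices x j 0 - cbar j 0) / c j 0) / tau j 0.

Lemma affine_al_rate j : affine (al_rate j).
Proof.
apply/affine_divr/affineB; first exact: affine_supply.
by apply/affine_divr/affineB; [exact: affine_prices|exact: affine_cst].
Qed.

Definition om_rate j x :=
  (supply x j 0 - d j 0 - D j j * st_om x j 0 - (C *m B *m st_th x) j 0) / M j j.

Lemma affine_om_rate j : affine (om_rate j).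
Proof.
apply/affine_divr/affineB; last exact: affine_flow.
apply: affineB; last by apply: affineZ; exact: affine_om.
by apply: affineB; [exact: affine_supply|exact: affine_cst].
Qed.

(** Every coordinate is affine except those of eta, which are either affine or zero. The jumps of
    the projection therefore do not affect boundedness. *)
Lemma field_bounded (r : R) : exists K, forall y, `|y| <= r -> `|f y| <= K.
Proof.
have aff g : affine g -> exists2 K : R, 0 <= K & forall y : state, `|y| <= r -> `|g y| <= K.
  by move=> ag; apply: llip_bounded (affine_llip _ ag) r.
suff /choice[K HK] : forall i, exists K : R, 0 <= K /\ forall y, `|y| <= r -> `|f y i 0| <= K.
  exists (\sum_i K i) => y yr; apply: cvnorm_leP => [|i].
    by apply: sumr_ge0 => i _; case: (HK i).
  have [_ /(_ y yr) /le_trans] := HK i; apply; rewrite (bigD1 i) //= ler_wpDr //.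
  by apply: sumr_ge0 => l _; case: (HK l).
apply: state_ind.
- move=> j; have := aff _ (affine_divr (Tq j j) _ (affineB _ _ (affine_prices j) (affine_al j))).
  move=> [K K0 HK]; exists K; split=> // y /HK; rewrite -field_qh; by rewrite mxE.
- move=> e; have := aff _ (affine_mulmx _ _ C^T (fun y : state => st_om y) e affine_om).
  move=> [K K0 HK]; exists K; split=> // y /HK; rewrite -field_th; by rewrite 2!mxE.
- have aS : affine (fun y => \sum_j (supply y j 0 - d j 0)).
    by apply: affine_sum => j; exact: affineB (affine_supply j) (affine_cst _).
  have [K K0 HK] := aff _ (affine_divr Tl _ (affineN _ aS)).
  exists K; split=> // y /HK; rewrite -field_la; by rewrite /st_la 3!mxE.
- move=> j; have [K K0 HK] := aff _ (affine_om_rate j).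
  exists K; split=> // y /HK; rewrite /om_rate -field_om; by rewrite 4!mxE.
- move=> j; have [K K0 HK] := aff _ (affine_al_rate j).
  exists K; split=> // y /HK; rewrite /al_rate -field_al; by rewrite 5!mxE.
- move=> e; have [K K0 HK] := aff _ (affine_divr (Te e e) _ (affine_slack e)).
  exists K; split=> // y /HK h; have := field_et y e; rewrite 5!mxE => ->.
  by case: ifP => // _; rewrite mul0r normr0.
Qed.

(** Half the squared negative part [N] of eta cannot grow: where eta is negative, the projected rate
    is nonnegative. *)
Lemma eta_ge0 (x : R -> state) : carath_sol f x -> (forall e, 0 <= st_et (x 0) e 0) ->
  forall t, 0 <= t -> forall e, 0 <= st_et (x t) e 0.
Proof.
move=> solx x0 t t0 e.
pose N (y : state) : R := Num.max (- st_et y e 0) 0.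
pose ie : 'I_(sdim n m) := rshift _ (rshift _ (rshift _ (rshift _ (rshift _ e)))).
have ieE (y : state) : y ie 0 = st_et y e 0 by rewrite !mxE.
have one (v : state -> R) y (w : 'I_(sdim n m) -> R) :
    \sum_i (if i == ie then v y else 0) * w i = v y * w ie.
  rewrite (bigD1 ie) //= eqxx big1 ?addr0 // => i /negbTE ->; exact: mul0r.
have := carath_lyapunov f x solx field_bounded (fun y => N y ^+ 2 / 2)
  (fun i y => if i == ie then - N y else 0) (1 / 2) 0 t 0.
move=> Hlyap.
have : N (x t) ^+ 2 / 2 - N (x 0) ^+ 2 / 2 <= 0 * (t - 0).
  apply: Hlyap => //.
  - move=> i; case: eqP => _; last exact: llip_cst.
    by apply/llipN/llip_max0/llipN/affine_llip/affine_et.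
  - move=> y z; rewrite (one (fun y => - N y)) !ieE.
    have h : (st_et z e 0 - st_et y e 0) ^+ 2 <= `|z - y| ^+ 2.
      rewrite -real_normK ?num_real // lerXn2r ?nnegrE //.
      by have := cvnorm_coord _ _ (z - y) ie; rewrite cvBE !ieE.
    rewrite /N !maxElt; do 2 case: ltP => ?; nra.
  - move=> r r0 rt; rewrite (one (fun y => - N y)) ieE mulNr oppr_le0 field_et.
    rewrite /N maxElt; case: ltP => h; first by rewrite mul0r.
    apply: mulr_ge0 => //; apply: divr_ge0; last by apply: ltW; case: pTe.
    by case: ifP => // /orP[/ltW //|]; lra.
have -> : N (x 0) = 0 by rewrite /N; apply/max_idPr; rewrite oppr_le0.
rewrite mul0r /N maxElt; case: ltP => h; nra.
Qed.

(** * Decrease of the Lyapunov function *)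

Definition lyapunov (xs x : state) : R := \sum_i weights i 0 * (x i 0 - xs i 0) ^+ 2 / 2.

Lemma lyapunov_decr (x : R -> state) xs (a b k : R) : carath_sol f x ->
  (forall e, 0 <= st_et (x 0) e 0) -> kkt xs -> 0 <= a -> a <= b ->
  (forall r, a <= r -> r <= b -> k <= dissipation xs (x r)) ->
  lyapunov xs (x b) - lyapunov xs (x a) <= - k * (b - a).
Proof.
move=> solx x0 kx a0 ab Hk.
apply: (carath_lyapunov f x solx field_bounded (lyapunov xs)
  (fun i y => weights i 0 * (y i 0 - xs i 0)) (\sum_i weights i 0)) => //.
- by move=> i; apply/llipZ/affine_llip/affineB; [exact: affine_coord|exact: affine_cst].
- by apply: sumr_ge0 => i _; apply/ltW/weights_gt0.
- move=> y z; rewrite /lyapunov -sumrB mulr_suml -big_split /=; apply: ler_sum => i _.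
  have h : (z i 0 - y i 0) ^+ 2 <= `|z - y| ^+ 2.
    rewrite -real_normK ?num_real // lerXn2r ?nnegrE //.
    by have := cvnorm_coord _ _ (z - y) i; rewrite cvBE.
  have := ler_wpM2l (ltW (weights_gt0 i)) h.
  have := mulr_ge0 (ltW (weights_gt0 i)) (sqr_ge0 (z i 0 - y i 0)).
  move: (weights i 0) (`|z - y| ^+ 2) => w q; nra.
- move=> r ar rb; apply: (@le_trans _ _ (- dissipation xs (x r))); last first.
    by rewrite lerN2; exact: Hk.
  under eq_bigr do rewrite -mulrA.
  by apply: lyapunov_rate => //; apply: eta_ge0 => //; lra.
Qed.

(** This is where [rho < 4 * c j 0] enters. Writing [a * p] through [(p + a) ^+ 2 - (p - a) ^+ 2]
    diagonalises the form, with coefficients [rho^-1 - (4 * c j 0)^-1] and [(4 * c j 0)^-1]. *)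
Lemma coupling_ge (j : 'I_n) : exists2 k : R, 0 < k & forall p a : R,
  k * (p ^+ 2 + a ^+ 2) <= (p - a) ^+ 2 / rho + a * p / c j 0.
Proof.
have cj := pc j; have r4 := rhoc j.
have k1 : 0 < rho^-1 - (4 * c j 0)^-1.
  by rewrite subr_gt0 ltf_pV2 ?posrE //; lra.
have k2 : 0 < (4 * c j 0)^-1 by rewrite invr_gt0; lra.
pose k := Num.min (rho^-1 - (4 * c j 0)^-1) (4 * c j 0)^-1.
have k0 : 0 < k by rewrite lt_min k1 k2.
exists k => // p a.
have -> : (p - a) ^+ 2 / rho + a * p / c j 0 =
    (p - a) ^+ 2 * (rho^-1 - (4 * c j 0)^-1) + (p + a) ^+ 2 * (4 * c j 0)^-1.
  by field; rewrite !gt_eqF.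
have h1 : k <= rho^-1 - (4 * c j 0)^-1 by rewrite ge_min lexx.
have h2 : k <= (4 * c j 0)^-1 by rewrite ge_min lexx orbT.
have := ler_wpM2l (sqr_ge0 (p - a)) h1; have := ler_wpM2l (sqr_ge0 (p + a)) h2.
have := mulr_ge0 (ltW k0) (addr_ge0 (sqr_ge0 p) (sqr_ge0 a)).
have : (p + a) ^+ 2 * k + (p - a) ^+ 2 * k = k * (p ^+ 2 + a ^+ 2) *+ 2 by ring.
rewrite mulr2n; lra.
Qed.

Definition node_dissipation (xs x : state) j : R :=
  D j j * st_om x j 0 ^+ 2
    + ((prices x j 0 - prices xs j 0) - (st_al x j 0 - st_al xs j 0)) ^+ 2 / rho
    + (st_al x j 0 - st_al xs j 0) * (prices x j 0 - prices xs j 0) / c j 0.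

Lemma dissipation_node_ge j : exists2 k : R, 0 < k & forall xs x,
  k * (st_om x j 0 ^+ 2 + (prices x j 0 - prices xs j 0) ^+ 2
       + (st_al x j 0 - st_al xs j 0) ^+ 2) <= node_dissipation xs x j.
Proof.
have [k k0 Hk] := coupling_ge j; have Dj := pD.2 j.
exists (Num.min k (D j j)); first by rewrite lt_min k0.
move=> xs x; rewrite /node_dissipation -2!addrA mulrDr.
apply: lerD; first by rewrite ler_wpM2r ?sqr_ge0 // ge_min lexx orbT.
apply: le_trans (Hk _ _).
by rewrite ler_wpM2r ?addr_ge0 ?sqr_ge0 // ge_min lexx.
Qed.

Lemma dissipation_node_le xs x : kkt xs -> (forall e, 0 <= st_et x e 0) ->
  forall j, 0 <= node_dissipation xs x j <= dissipation xs x.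
Proof.
move=> kx ex j.
have N i : 0 <= node_dissipation xs x i.
  have [k k0 /(_ xs x)] := dissipation_node_ge i; apply: le_trans.
  by rewrite mulr_ge0 ?(ltW k0) // !addr_ge0 ?sqr_ge0.
rewrite N /= /dissipation (bigD1 j) //= -addrA ler_wpDr //.
rewrite addr_ge0 ?sumr_ge0 // => [i _|]; first exact: N.
rewrite oppr_ge0; apply: sumr_le0 => e _.
by rewrite mulr_ge0_le0 // (kkt_slack _ kx).
Qed.

Lemma dissipation_edge_le xs x : kkt xs -> (forall e, 0 <= st_et x e 0) ->
  forall e, 0 <= - (st_et x e 0 * slack xs e 0) <= dissipation xs x.
Proof.
move=> kx ex e.
have N i : 0 <= - (st_et x i 0 * slack xs i 0).
  by rewrite oppr_ge0 mulr_ge0_le0 // (kkt_slack _ kx).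
rewrite N /= /dissipation (bigD1 e) //= opprD addrA [X in _ <= X + _]addrC -addrA ler_wpDr //.
rewrite addr_ge0 //.
  by apply: sumr_ge0 => j _; case/andP: (dissipation_node_le xs x kx ex j).
by rewrite -sumrN sumr_ge0.
Qed.

Lemma dissipation_ge0 xs x : kkt xs -> (forall e, 0 <= st_et x e 0) ->
  0 <= dissipation xs x.
Proof.
move=> kx ex; rewrite /dissipation addr_ge0 //.
  by apply: sumr_ge0 => j _; case/andP: (dissipation_node_le xs x kx ex j).
rewrite oppr_ge0; apply: sumr_le0 => e _.
by rewrite mulr_ge0_le0 // (kkt_slack _ kx).
Qed.

Lemma llip_dissipation xs : llip (dissipation xs).
Proof.
have sub (g : state -> R) r : affine g -> llip (fun x => g x - r).
  by move=> ag; exact/affine_llip/affineB/affine_cst.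
apply: llipD.
  apply: llip_sum => j; apply: llipD.
    apply: llipD; first exact/llipZ/llip_sqr/affine_llip/affine_om.
    apply: llipM (llip_cst _); apply/llip_sqr/affine_llip/affineB.
      exact: affineB (affine_prices j) (affine_cst _).
    exact: affineB (affine_al j) (affine_cst _).
  apply: llipM (llip_cst _); apply: llipM; apply: sub; first exact: affine_al.
  exact: affine_prices.
apply/llipN/llip_sum => e; apply: llipM (llip_cst _).
exact/affine_llip/affine_et.
Qed.

(** The constant compares the sup norm with the weighted norm, so it depends on neither the centre
    nor the initial time. Convergence needs both: the centre becomes a cluster point and the clock
    restarts at a late time. *)
Lemma uniform_stability : exists2 K : R, 0 < K & forall (x : R -> state) xs (s t : R),
  carath_sol f x -> (forall e, 0 <= st_et (x 0) e 0) -> kkt xs ->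
  0 <= s -> s <= t -> `|x t - xs| <= K * `|x s - xs|.
Proof.
pose W : R := \sum_i weights i 0.
have W0 : 0 <= W by apply: sumr_ge0 => i _; exact/ltW/weights_gt0.
have t0 i : 0 <= W / weights i 0 by rewrite divr_ge0 // ltW // weights_gt0.
pose K := 1 + \sum_i W / weights i 0.
have K1 : 1 <= K by rewrite lerDl; apply: sumr_ge0 => i _; exact: t0.
exists K => [|x xs s t solx x0 kx s0 st]; first by lra.
have Vle : lyapunov xs (x t) <= lyapunov xs (x s).
  have := lyapunov_decr x xs s t 0 solx x0 kx s0 st; rewrite oppr0 mul0r subr_le0; apply.
  by move=> r sr rt; apply: dissipation_ge0 => //; apply: eta_ge0 => //; lra.
have K0 : 0 <= K by lra.
apply: cvnorm_leP => [|i]; first exact: mulr_ge0.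
rewrite cvBE -(@ler_pXn2r _ 2) ?nnegrE ?mulr_ge0 // real_normK ?num_real // exprMn.
have wi := weights_gt0 i.
have V1 : weights i 0 * (x t i 0 - xs i 0) ^+ 2 / 2 <= lyapunov xs (x t).
  rewrite /lyapunov (bigD1 i) //= ler_wpDr //; apply: sumr_ge0 => l _.
  by rewrite divr_ge0 // mulr_ge0 ?sqr_ge0 // ltW // weights_gt0.
have V2 : lyapunov xs (x s) <= W * `|x s - xs| ^+ 2 / 2.
  rewrite /lyapunov !mulr_suml; apply: ler_sum => l _; rewrite ler_wpM2r //.
  rewrite ler_wpM2l ?(ltW (weights_gt0 l)) //.
  rewrite -real_normK ?num_real // lerXn2r ?nnegrE //.
  by have := cvnorm_coord _ _ (x s - xs) l; rewrite cvBE.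
have : (x t i 0 - xs i 0) ^+ 2 <= W / weights i 0 * `|x s - xs| ^+ 2.
  rewrite mulrAC ler_pdivlMr // mulrC; lra.
move/le_trans; apply; rewrite ler_wpM2r ?sqr_ge0 //.
have : W / weights i 0 <= K.
  rewrite /K (bigD1 i) //=; have : 0 <= \sum_(l | l != i) W / weights l 0.
    by apply: sumr_ge0 => l _; exact: t0.
  lra.
move: (W / weights i 0) => w; nra.
Qed.

(** The discontinuous eta equation is never taken to the limit: the conditions on eta and the slack
    at a cluster point come from invariance and zero dissipation. Rates are needed only for alpha
    and omega, where they are affine. *)
Lemma converges_to_kkt (x : R -> state) xs : carath_sol f x ->
  (forall e, 0 <= st_et (x 0) e 0) -> kkt xs ->
  exists2 l, kkt l & x t @[t --> +oo] --> l.
Proof.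
move=> solx x0 kx.
have [K K0 HK] := uniform_stability.
have etx t : 0 <= t -> forall e, 0 <= st_et (x t) e 0 by exact: eta_ge0.
have xb t : 0 <= t -> `|x t| <= K * `|x 0 - xs| + `|xs|.
  move=> t0; rewrite -[x t](subrK xs); apply: (le_trans (ler_normD _ _)).
  by rewrite lerD2r HK.
have pos : \forall t \near +oo, 0 <= t :> R by exact: nbhs_pinfty_ge.
have dis0 e : 0 < e -> \forall t \near +oo, dissipation xs (x t) < e.
  have Vdec s t : 0 <= s -> s <= t -> lyapunov xs (x t) <= lyapunov xs (x s).
    move=> s0 st; have := lyapunov_decr x xs s t 0 solx x0 kx s0 st.
    rewrite oppr0 mul0r subr_le0; apply.
    by move=> r sr rt; apply: dissipation_ge0 => //; apply: etx; lra.
  have Vge0 t : 0 <= lyapunov xs (x t).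
    apply: sumr_ge0 => i _.
    by rewrite divr_ge0 // mulr_ge0 ?sqr_ge0 // ltW // weights_gt0.
  have [l Vl] := nonincreasing_cvgy R (lyapunov xs \o x) 0 Vge0 Vdec.
  have [L L0 HL] := bounded_sol_lip f x solx field_bounded _ xb _ (llip_dissipation xs).
  apply: (barbalat R (dissipation xs \o x) (fun t => - lyapunov xs (x t)) L (- l)) => //=.
  - by move=> s t s0 st; exact: le_trans (ler_norm _) (HL s t s0 st).
  - move=> q a b q0 a0 ab Hq; have := lyapunov_decr x xs a b q solx x0 kx a0 ab Hq; lra.
  - exact: cvgN.
have sq0 (g : R -> R) (k : R) : 0 < k ->
    (forall t, 0 <= t -> k * g t ^+ 2 <= dissipation xs (x t)) -> g t @[t --> +oo] --> 0.
  move=> k0 Hg; apply/cvgrPdist_lt => e e0.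
  near=> t; rewrite distrC subr0 -(@ltr_pXn2r _ 2) ?nnegrE ?(ltW e0) //.
  rewrite real_normK ?num_real // -(ltr_pM2l k0); apply: le_lt_trans (Hg t _) _.
    by near: t.
  by near: t; apply: dis0; rewrite mulr_gt0 // exprn_gt0.
have om_lim j : st_om (x t) j 0 @[t --> +oo] --> (0 : R).
  have [k k0 Hk] := dissipation_node_ge j; apply: (sq0 _ k k0) => t t0.
  have /andP[_ h] := dissipation_node_le xs (x t) kx (etx t t0) j.
  apply: le_trans h; apply: le_trans (Hk xs (x t)); rewrite ler_wpM2l ?(ltW k0) //.
  by rewrite -addrA lerDl addr_ge0 ?sqr_ge0.
have al_lim j : st_al (x t) j 0 @[t --> +oo] --> st_al xs j 0.
  apply/subr_cvg0; have [k k0 Hk] := dissipation_node_ge j; apply: (sq0 _ k k0) => t t0.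
  have /andP[_ h] := dissipation_node_le xs (x t) kx (etx t t0) j.
  apply: le_trans h; apply: le_trans (Hk xs (x t)); rewrite ler_wpM2l ?(ltW k0) //.
  by rewrite lerDr addr_ge0 ?sqr_ge0.
have [|l Hl] := @cluster_point R (sdim n m) R +oo x (K * `|x 0 - xs| + `|xs|) _.
  by apply: filterS pos => t; exact: xb.
have lim_le0 g : llip g -> (forall e, 0 < e -> \forall t \near +oo, g (x t) < e) -> g l <= 0.
  by move=> lg Hg; exact: (cluster_le0 x _ xb l g lg Hl Hg).
have et0 e : 0 <= st_et l e 0.
  rewrite -oppr_le0; apply: (lim_le0 (fun y => - st_et y e 0)).
    exact/llipN/affine_llip/affine_et.
  by move=> q q0; apply: filterS pos => t t0; have := etx t t0 e; lra.
(* Zero dissipation at [l] fixes omega, prices and alpha there, and later yields complementarity. *)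
have dl : dissipation xs l = 0.
  apply: le_anti; rewrite dissipation_ge0 // andbT.
  by apply: (lim_le0 (dissipation xs)) => //; exact: llip_dissipation.
have sq_le0 (r : R) : r ^+ 2 <= 0 -> r = 0.
  by move=> r0; apply/eqP; rewrite -sqrf_eq0 eq_le r0 sqr_ge0.
have node0 j : [/\ st_om l j 0 = 0, prices l j 0 = prices xs j 0 &
    st_al l j 0 = st_al xs j 0].
  have [k k0 /(_ xs l)] := dissipation_node_ge j.
  have /andP[_] := dissipation_node_le xs l kx et0 j; rewrite dl => h1 h2.
  have := le_trans h2 h1; rewrite pmulr_rle0 // => h.
  have := sqr_ge0 (st_om l j 0); have := sqr_ge0 (prices l j 0 - prices xs j 0).
  have := sqr_ge0 (st_al l j 0 - st_al xs j 0) => a1 a2 a3.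
  by split; [|apply: subr0_eq|apply: subr0_eq]; apply: sq_le0; lra.
have sqz g : affine g -> (forall e, 0 < e -> \forall t \near +oo, g (x t) ^+ 2 < e) -> g l = 0.
  move=> ag Hg; apply: sq_le0; apply: (lim_le0 (fun y => g y ^+ 2)) => //.
  exact/llip_sqr/affine_llip.
(* Alpha and omega converge because the dissipation controls them, so their rates vanish at infinity
   and hence at [l]. *)
have al0 j : al_rate j l = 0.
  have alE (y : state) : st_al y j 0 =
      y (rshift _ (rshift _ (rshift _ (rshift _ (lshift _ j))))) 0 by rewrite !mxE.
  apply: sqz; first exact: affine_al_rate.
  apply: (coord_barbalat f x solx field_bounded _ xb
    (rshift _ (rshift _ (rshift _ (rshift _ (lshift _ j)))))).
  - exact/affine_llip/affine_al_rate.
  - by move=> y; rewrite /al_rate -field_al alE.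
  - by have := al_lim j; under eq_fun do rewrite alE; exact.
have om0 j : om_rate j l = 0.
  have omE (y : state) : st_om y j 0 = y (rshift _ (rshift _ (rshift _ (lshift _ j)))) 0.
    by rewrite !mxE.
  apply: sqz; first exact: affine_om_rate.
  apply: (coord_barbalat f x solx field_bounded _ xb
    (rshift _ (rshift _ (rshift _ (lshift _ j))))).
  - exact/affine_llip/affine_om_rate.
  - by move=> y; rewrite /om_rate -field_om omE.
  - by have := om_lim j; under eq_fun do rewrite omE; exact.
have q0 j : supply l j 0 = (prices l j 0 - cbar j 0) / c j 0.
  have /eqP := al0 j; rewrite /al_rate mulf_eq0 invr_eq0 (gt_eqF (ptau j)) orbF.
  by rewrite subr_eq0 => /eqP.
(* With zero alpha rate, the prices determine the supply, and the prices at [l] and [xs] agree. *)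
have slackE e : slack l e 0 = slack xs e 0.
  rewrite /slack; suff -> : supply l = supply xs by [].
  apply/matrixP => j i; rewrite [i]ord1.
  by rewrite q0 (kkt_q _ kx); have [_ -> _] := node0 j.
have kl : kkt l.
  split=> // [j|j|j|e|e].
  - by have [] := node0 j.
  - by have [_ -> ->] := node0 j; exact: kkt_al.
  - have /eqP := om0 j; rewrite /om_rate mulf_eq0 invr_eq0 (gt_eqF (pM.2 j)) orbF.
    by have [-> _ _] := node0 j; rewrite mulr0 subr0 subr_eq0 => /eqP.
  - by rewrite slackE (kkt_slack _ kx).
  - rewrite slackE; have := dissipation_edge_le xs l kx et0 e; rewrite dl => h.
    by apply/eqP; rewrite -oppr_eq0; apply/eqP/le_anti; rewrite andbC.
(* The centre is now [l] itself: once the trajectory is within [e / K] of it, uniform stability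
   keeps it within [e]. *)
exists l => //; apply/cvgrPdist_lt => e e0.
have [|s s0 sl] := Hl (e / K) _ _ pos; first exact: divr_gt0.
near=> t; rewrite distrC.
have st : s <= t by near: t; apply: nbhs_pinfty_ge; rewrite num_real.
apply: (le_lt_trans (HK x l s t solx x0 kl s0 st)).
by rewrite mulrC -ltr_pdivlMr.
Unshelve. all: by end_near.
Qed.


(** * Error bound for approximate KKT points *)

Definition relaxed (S : {set 'I_(m + m)}) (dl : R) : set state := fun x =>
  ((forall j, `|st_om x j 0| <= dl) /\ (forall j, `|prices x j 0 - st_al x j 0| <= dl)) /\
  ((forall j, `|supply x j 0 - (prices x j 0 - cbar j 0) / c j 0| <= dl) /\
   (forall j, `|supply x j 0 - d j 0 - (C *m B *m st_th x) j 0| <= dl)) /\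
  (forall e, if e \in S then `|slack x e 0| <= dl /\ - st_et x e 0 <= dl
             else slack x e 0 <= dl /\ `|st_et x e 0| <= dl).

(** Complementarity is not affine, but fixing the set [S] where the slack is to vanish, with eta
    vanishing elsewhere, turns it into affine conditions. *)
Lemma polyfam_relaxed S : polyfam (relaxed S).
Proof.
apply: polyfam_and; first apply: polyfam_and.
- by apply: polyfam_all => j; apply/polyfam_norm/affine_om.
- apply: polyfam_all => j; apply/polyfam_norm/affineB; [exact: affine_prices|exact: affine_al].
apply: polyfam_and; first apply: polyfam_and.
- apply: polyfam_all => j; apply/polyfam_norm/affineB; first exact: affine_supply.
  by apply/affine_divr/affineB; [exact: affine_prices|exact: affine_cst].
- apply: polyfam_all => j; apply/polyfam_norm/affineB; last exact: affine_flow.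
  by apply: affineB; [exact: affine_supply|exact: affine_cst].
apply: polyfam_all => e; case: (e \in S); apply: polyfam_and.
- exact/polyfam_norm/affine_slack.
- exact/polyfam_le/affineN/affine_et.
- exact/polyfam_le/affine_slack.
- exact/polyfam_norm/affine_et.
Qed.

Lemma relaxed0_kkt S x : relaxed S 0 x -> kkt x.
Proof.
move=> [[r1 r2] [[r3 r4] r5]]; split.
- by move=> j; apply/eqP; rewrite -normr_le0.
- by move=> j; apply/eqP; rewrite -subr_eq0 -normr_le0.
- by move=> j; apply/eqP; rewrite -subr_eq0 -normr_le0.
- by move=> j; apply/eqP; rewrite -subr_eq0 -normr_le0.
- by move=> e; have := r5 e; case: ifP => _ [] // + _; rewrite normr_le0 => /eqP ->.
- move=> e; have := r5 e; case: ifP => _ []; first by rewrite oppr_le0.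
  by rewrite normr_le0 => _ /eqP ->.
- move=> e; have := r5 e; case: ifP => _ [].
    by rewrite normr_le0 => /eqP -> _; rewrite mulr0.
  by rewrite normr_le0 => _ /eqP ->; rewrite mul0r.
Qed.

(** There are finitely many sets [S], so the constants can be summed and the radii minimised. An
    infeasible [S] is included: its relaxations are empty below its radius. *)
Lemma relaxed_near_kkt : exists K d0 : R, [/\ 0 < K, 0 < d0 &
  forall S dl x, 0 <= dl -> dl <= d0 -> relaxed S dl x ->
    exists2 y, kkt y & `|y - x| <= K * dl].
Proof.
have /choice[Kd HKd] : forall S, exists Kd : R * R, [/\ 0 < Kd.1, 0 < Kd.2 &
    forall dl x, 0 <= dl -> dl <= Kd.2 -> relaxed S dl x ->
      exists2 y, kkt y & `|y - x| <= Kd.1 * dl].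
  move=> S; have [K [d0 [K0 d00 HH]]] := hoffman _ (polyfam_relaxed S).
  exists (K, d0); split=> // dl x h1 h2 /HH[] // y ry yx.
  by exists y => //; exact: relaxed0_kkt ry.
exists (1 + \sum_S (Kd S).1), (\big[Num.min/1]_S (Kd S).2); split.
- by rewrite ltr_pwDl // sumr_ge0 // => S _; case: (HKd S) => /ltW.
- by apply: lt_bigmin => // S _; case: (HKd S).
- move=> S dl x dl0 dle rx; have [k0 _ /(_ dl x dl0)] := HKd S.
  case=> // [|y ky yx]; first by apply: le_trans dle _; exact: bigmin_le.
  exists y => //; apply: le_trans yx _; rewrite ler_wpM2r // (bigD1 S) //=.
  have : 0 <= \sum_(T | T != S) (Kd T).1 by rewrite sumr_ge0 // => T _; case: (HKd T) => /ltW.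
  lra.
Qed.

Lemma field0_relaxed x (dl : R) : 0 <= dl -> f x = 0 ->
  (forall e, - dl <= st_et x e 0) -> exists S, relaxed S dl x.
Proof.
move=> dl0 /field0P[e1 e2 e3 e4 e5] etx.
(* Outside the indices of zero slack, [field0P] gives nonpositive eta, which the lower bound places
   within [dl] of 0. *)
exists [set e | slack x e 0 == 0]%SET; split; first split.
- by move=> j; rewrite e1 normr0.
- by move=> j; rewrite e2 subrr normr0.
split; first split.
- by move=> j; rewrite e3 subrr normr0.
- by move=> j; rewrite e4 subrr normr0.
move=> e; rewrite inE; case: eqP => [->|ne]; first by rewrite normr0 lerNl.
case: (e5 e) => // -[s0 t0]; split; first exact: le_trans dl0.
by rewrite ler_norml etx (le_trans t0).
Qed.

(** * Existence of a KKT point *)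

Hypothesis rangeC : forall v : 'cV[R]_n, exists th : 'cV[R]_m,
  forall j, `|v j 0 - (C *m B *m th) j 0| <= `|\sum_i v i 0|.

(** Stationarity of a penalised minimiser makes the price equations exact. Only feasibility errors
    remain, and a large penalty makes them small. *)
Lemma approximate_kkt x0 (dl : R) : f x0 = 0 -> 0 < dl -> exists S x, relaxed S dl x.
Proof.
move=> /field0P[_ _ _ fl0 sl0] dl0.
pose q0 := supply x0.
have ex0 e : Num.max (excess d H F q0 e) 0 = 0.
  by apply/max_idPr; have := sl0 e; rewrite /slack /excess -/q0 => -[-> //|[]].
have bal0 : balance d q0 = 0.
  rewrite /balance -[RHS](sum_mulC (B *m st_th x0)).
  by apply: eq_bigr => j _; rewrite fl0 mulmxA.
pose A := cost c cbar q0 + \sum_j cbar j 0 ^+ 2 / c j 0.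
have costge q : - \sum_j cbar j 0 ^+ 2 / c j 0 <= cost c cbar q.
  apply: le_trans (cost_coercive c cbar pc q); rewrite lerDr; apply: sumr_ge0 => j _.
  by apply: mulr_ge0; [apply: divr_ge0 => //; exact: ltW|exact: sqr_ge0].
have A0 : 0 <= A by rewrite /A; have := costge q0; lra.
(* The supply [q0] is feasible, so [k / 2] times the squared violation of the minimiser is at most
   the cost gap [A]. This [k] brings that violation below [dl ^+ 2]. *)
pose k := (2 * A + 1) / dl ^+ 2.
have dl2 : 0 < dl ^+ 2 by rewrite exprn_gt0.
have k0 : 0 < k by rewrite divr_gt0 //; lra.
have [q qmin] := penalty_min c cbar d H F pc k (ltW k0).
have qst := penalty_stationary c cbar d H F pc k q (ltW k0) qmin.
have small : \sum_e Num.max (excess d H F q e) 0 ^+ 2 + balance d q ^+ 2 <= dl ^+ 2.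
  have := qmin q0; rewrite {2}/penalty bal0 big1 => [|e _]; last by rewrite ex0 expr0n.
  rewrite expr0n addr0 mulr0 addr0 /penalty => h.
  have {}h : k / 2 * (\sum_e Num.max (excess d H F q e) 0 ^+ 2 + balance d q ^+ 2) <= A.
    by rewrite /A; have := costge q; lra.
  rewrite -(ler_pM2l k0) {2}/k divfK ?gt_eqF //.
  move: h; move: (\sum_e _ + _) => s; lra.
have max_ge0 e : 0 <= Num.max (excess d H F q e) 0 by rewrite le_max lexx orbT.
have ex_small e : Num.max (excess d H F q e) 0 <= dl.
  rewrite -(@ler_pXn2r _ 2) ?nnegrE ?(ltW dl0) //; apply: le_trans small.
  rewrite (bigD1 e) //= -addrA lerDl addr_ge0 ?sqr_ge0 // sumr_ge0 // => i _.
  exact: sqr_ge0.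
have bal_small : `|balance d q| <= dl.
  rewrite -(@ler_pXn2r _ 2) ?nnegrE ?(ltW dl0) // real_normK ?num_real //.
  by apply: le_trans small; rewrite lerDr sumr_ge0 // => i _; exact: sqr_ge0.
have [th Hth] := rangeC (q - d).
(* The multipliers are read off the penalty, alpha is the marginal cost, and omega is zero, which
   makes the prices equal to alpha and the supply equal to [q]. *)
pose x : state := mk_state q th (- k * balance d q) 0
  (\col_j (c j 0 * q j 0 + cbar j 0)) (\col_e (k * Num.max (excess d H F q e) 0)).
have xpr j : prices x j 0 = c j 0 * q j 0 + cbar j 0.
  rewrite pricesE /x st_laK st_etK st_omK mxE [X in _ - X]mxE subr0.
  under eq_bigr do rewrite mxE mulrCA.
  rewrite -mulr_sumr; have := qst j; lra.
have xal j : st_al x j 0 = c j 0 * q j 0 + cbar j 0 by rewrite /x st_alK mxE.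
have xsup j : supply x j 0 = q j 0.
  by rewrite supplyE xpr xal subrr mul0r add0r /x st_qhK.
have xsl e : slack x e 0 = excess d H F q e.
  rewrite /slack /excess; suff -> : supply x = q by [].
  by apply/matrixP => i j; rewrite [j]ord1 xsup.
(* Outside this set the penalty multiplier is exactly zero. *)
exists [set e | 0 < excess d H F q e]%SET, x; split; first split.
- by move=> j; rewrite /x st_omK mxE normr0 ltW.
- by move=> j; rewrite xpr xal subrr normr0 ltW.
split; first split.
- move=> j; rewrite xsup xpr addrK mulrC mulKf ?subrr ?normr0 ?(ltW dl0) //.
  by rewrite gt_eqF.
- move=> j; rewrite xsup /x st_thK; have := Hth j; rewrite cvBE => /le_trans; apply.
  by rewrite (_ : \sum_i _ = balance d q) //; apply: eq_bigr => i _; rewrite cvBE.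
move=> e; rewrite inE xsl /x st_etK mxE; case: ltP => h.
  split; first by rewrite gtr0_norm //; have := ex_small e; rewrite (max_idPl (ltW h)).
  apply: (@le_trans _ _ 0); last exact: ltW.
  by rewrite oppr_le0; apply: mulr_ge0; exact: ltW.
by rewrite mulr0 normr0 (le_trans h) // ltW.
Qed.

(** No limit is taken: an approximate point of the fixed accuracy [d0] already forces an exact one
    nearby. *)
Lemma kkt_exists x0 : f x0 = 0 -> exists xs, kkt xs.
Proof.
move=> fx0; have [K [d0 [K0 d00 HK]]] := relaxed_near_kkt.
have [S [x rx]] := approximate_kkt x0 d0 fx0 d00.
by have [y ky _] := HK S d0 x (ltW d00) (lexx _) rx; exists y.
Qed.

Theorem system_stable : [set x | f x = 0] !=set0 ->
  GAS_on f [set x | f x = 0] [set x | forall e, 0 <= st_et x e 0] /\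
  (forall x : R -> state, carath_sol f x -> (forall e, 0 <= st_et (x 0) e 0) ->
     (exists K : R, forall t, 0 <= t -> `|x t| <= K) /\
     (exists2 xs, f xs = 0 & x t @[t --> +oo] --> xs)).
Proof.
move=> [x0 /= fx0]; have [xs kx] := kkt_exists x0 fx0.
have [K K0 HK] := uniform_stability.
split; [split|].
- move=> e e0; have [L [d0 [L0 d00 HL]]] := relaxed_near_kkt.
  (* A start within [dl] of a zero of the field is within [(L + 1) * dl] of a KKT point, and uniform
     stability multiplies this by [K]. *)
  pose dl := Num.min d0 (e / ((K + 1) * (L + 1))).
  have KL : 0 < (K + 1) * (L + 1) by rewrite mulr_gt0 //; lra.
  have dl0 : 0 < dl by rewrite lt_min d00 divr_gt0.
  exists dl => // x solx x0_ge0 [y /= fy xy] t t0.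
  (* The start has nonnegative eta, so the nearby zero [y] has eta at least [- dl]. *)
  have [|S rS] := field0_relaxed y dl (ltW dl0) fy.
    move=> i; have := cvnorm_coord _ _ (x 0 - y)
      (rshift _ (rshift _ (rshift _ (rshift _ (rshift _ i))))).
    rewrite cvBE => /le_lt_trans /(_ xy).
    have := x0_ge0 i; rewrite 5!mxE => h1.
    by rewrite [in leRHS]/st_et 5!mxE ltr_norml => /andP[_]; lra.
  have [|z kz zy] := HL S dl y (ltW dl0) _ rS; first by rewrite ge_min lexx.
  exists z; first exact: kkt_field0.
  apply: (le_lt_trans (HK x z 0 t solx x0_ge0 kz (lexx _) t0)).
  have h1 : `|x 0 - z| <= (L + 1) * dl.
    have := ler_distD y (x 0) z; rewrite (distrC y z); move: xy zy; lra.
  have h2 : dl <= e / ((K + 1) * (L + 1)) by rewrite ge_min lexx orbT.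
  have := ler_wpM2l (ltW KL) h2; rewrite mulrCA divff ?mulr1 ?gt_eqF // => h3.
  have h4 := ler_wpM2l (ltW K0) h1.
  have h5 : 0 < (L + 1) * dl by rewrite mulr_gt0 //; lra.
  move: h3; rewrite -mulrA mulrDl mul1r; lra.
- move=> x solx x0_ge0 e e0; have [l kl xl] := converges_to_kkt x xs solx x0_ge0 kx.
  have /cvgrPdist_lt /(_ e e0) := xl; apply: filterS => t lt.
  by exists l; [exact: kkt_field0|rewrite distrC].
- move=> x solx x0_ge0; split.
    exists (K * `|x 0 - xs| + `|xs|) => t t0.
    have := HK x xs 0 t solx x0_ge0 kx (lexx _) t0.
    by have := ler_normD (x t - xs) xs; rewrite subrK; lra.
  have [l kl xl] := converges_to_kkt x xs solx x0_ge0 kx.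
  by exists l; [exact: kkt_field0|exact: xl].
Qed.

End System.

Theorem theorem5 (R : realType) (n m : nat) (src dst : 'I_m -> 'I_n)
  (B : 'M[R]_m) (D M Tq : 'M[R]_n) (Tl : R) (Te : 'M[R]_(m + m))
  (tau c cbar d : 'cV[R]_n) (Fup Flow : 'cV[R]_m) (Ldag : 'M[R]_n) (rho : R) :
  no_self_loops src dst -> graph_connected src dst ->
  positive_diag B -> positive_diag D -> positive_diag M ->
  positive_diag Tq -> 0 < Tl -> positive_diag Te ->
  (forall j, 0 < tau j 0) -> (forall j, 0 < c j 0) ->
  0 < rho -> (forall j, rho < 4 * c j 0) ->
  let C := incidence R src dst in
  let L := C *m B *m C^T in
  is_MP_inverse L Ldag ->
  let H := (col_mx (B *m C^T *m Ldag) (- (B *m C^T *m Ldag)))^T in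
  let F := col_mx Fup (- Flow) in
  let f := field C B D M Tq Tl Te tau c cbar d H F rho in
  let E := [set x | f x = 0] in
  let I := [set x | forall e, 0 <= st_et x e 0] in
  E !=set0 ->
  GAS_on f E I /\
  (forall x, carath_sol f x -> I (x 0) ->
     (exists K : R, forall t, 0 <= t -> `|x t| <= K) /\
     (exists2 xs, E xs & x t @[t --> +oo] --> xs)).
Proof.
move=> noloop conn pB pD pM pTq pTl pTe ptau pc prho rhoc C L MP H F f E I E0.
(* The graph enters through three facts: zero column sums of [C], constants as the kernel of [C^T],
   and the realisation of injections by flows up to their total. *)
exact: (system_stable R n m C B D M Tq Tl Te tau c cbar d H F rho pB pD pM pTq pTl pTe
  ptau pc prho rhoc (incidence_col_sum src dst noloop) (incidence_ker src dst noloop conn)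
  (flow_residual src dst noloop conn B Ldag pB MP) E0).
Qed.
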